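(* Let $Y$ be a dissociated RCE matrix with a fixed AHK representation, let $h$ be a $p\times q$ kernel function with $\mathbb{E}[h(Y_{[p],[q]})^2]<\infty$, and let $(m_N,n_N)_{N\ge1}$ satisfy $m_N+n_N=N$, $m_N/N\to\rho$, $n_N/N\to1-\rho$ with $\rho\in(0,1)$. Then $$\widehat{v}^{h;1,0}_N\xrightarrow[N\to\infty]{\mathbb{P}}v^{1,0}_h\quad\text{and}\quad\widehat{v}^{h;0,1}_N\xrightarrow[N\to\infty]{\mathbb{P}}v^{0,1}_h.$$ As a consequence, $\widehat{V}^h_N\xrightarrow[N\to\infty]{\mathbb{P}}V^h$.
   Context: Notation: $\mathbb{N}=\{1,2,\dots\}$, $[n]=\{1,\dots,n\}$, and $\mathcal{P}_k(A)$ is the set of subsets of $A$ of cardinality $k$. RCE matrices. An infinite real random matrix $Y=(Y_{ij})_{i,j\ge1}$ is row-column exchangeable (RCE) if for all finite permutations $\sigma_1,\sigma_2$ of $\mathbb{N}$, $(Y_{\sigma_1(i)\sigma_2(j)})_{i,j\ge1}$ has the same distribution as $Y$. It is dissociated if for all $m,n$, $(Y_{ij})_{i\le m,j\le n}$ is independent of $(Y_{ij})_{i>m,j>n}$. AHK (Aldous-Hoover-Kallenberg) representation. For a dissociated RCE matrix $Y$ one fixes a measurable function $\phi$ and mutually independent families $(\xi_i)_{i\ge1},(\eta_j)_{j\ge1},(\zeta_{ij})_{i,j\ge1}$ of i.i.d. uniform $[0,1]$ variables with $Y_{ij}=\phi(\xi_i,\eta_j,\zeta_{ij})$ almost surely.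 Kernels. A kernel function of size $p\times q$ ($p,q\ge1$) is a measurable $h:\mathcal{M}_{p,q}(\mathbb{R})\to\mathbb{R}$ invariant under permutations of the rows and of the columns of its matrix argument. For $\mathbf{i}\in\mathcal{P}_p(\mathbb{N})$, $\mathbf{j}\in\mathcal{P}_q(\mathbb{N})$, $h(Y_{\mathbf{i},\mathbf{j}})$ is $h$ applied to the submatrix of $Y$ with rows $\mathbf{i}$ and columns $\mathbf{j}$ (in any order). Asymptotic variance. $v^{1,0}_h:=\mathrm{Var}(\mathbb{E}[h(Y_{[p],[q]})\mid\xi_1])$, $v^{0,1}_h:=\mathrm{Var}(\mathbb{E}[h(Y_{[p],[q]})\mid\eta_1])$, $V^h:=\frac{p^2}{\rho}v^{1,0}_h+\frac{q^2}{1-\rho}v^{0,1}_h$. Estimators (for $N$ large enough). For $i\in[m_N]$, $j\in[n_N]$, $$\widehat{\mu}^{h,(i)}_N=\binom{m_N-1}{p-1}^{-1}\binom{n_N}{q}^{-1}\sum_{\substack{\mathbf{i}\in\mathcal{P}_p([m_N]),\ i\in\mathbf{i}\\ \mathbf{j}\in\mathcal{P}_q([n_N])}}h(Y_{\mathbf{i},\mathbf{j}}),\qquad \widehat{\nu}^{h,(j)}_N=\binom{m_N}{p}^{-1}\binom{n_N-1}{q-1}^{-1}\sum_{\substack{\mathbf{i}\in\mathcal{P}_p([m_N])\\ \mathbf{j}\in\mathcal{P}_q([n_N]),\ j\in\mathbf{j}}}h(Y_{\mathbf{i},\mathbf{j}}),$$ $$\widehat{v}^{h;1,0}_N=\binom{m_N}{2}^{-1}\sum_{1\le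 i_1<i_2\le m_N}\frac{(\widehat{\mu}^{h,(i_1)}_N-\widehat{\mu}^{h,(i_2)}_N)^2}{2},\qquad \widehat{v}^{h;0,1}_N=\binom{n_N}{2}^{-1}\sum_{1\le j_1<j_2\le n_N}\frac{(\widehat{\nu}^{h,(j_1)}_N-\widehat{\nu}^{h,(j_2)}_N)^2}{2},$$ and $\widehat{V}^h_N:=\frac{p^2}{\rho}\widehat{v}^{h;1,0}_N+\frac{q^2}{1-\rho}\widehat{v}^{h;0,1}_N$. *)

(* Defs.v *)
From HB Require Import structures.
From mathcomp Require Import all_boot all_order perm all_algebra.
From mathcomp Require Import all_classical all_reals all_analysis.
From mathcomp Require Import measurable_realfun.

Set Implicit Arguments.
Unset Strict Implicit.
Unset Printing Implicit Defensive.

Import Order.TTheory GRing.Theory Num.Theory.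
Import numFieldNormedType.Exports.

Local Open Scope classical_set_scope.
Local Open Scope ring_scope.

(* Rows and columns are indexed from 0: the row i of the mathematical text
   (i >= 1) is the index i.-1 here, [m] is 'I_m, and xi_1 is xi 0. *)

Section sigma_algebras.
Context {R : realType}.

(* sigma(X_i : i \in D) *)
Definition family_sigma (I T : Type) (D : set I) (X : I -> T -> R) :
    set (set T) :=
  <<s \bigcup_(i in D) preimage_set_system setT (X i) measurable >>.

(* the product sigma-algebra on R^(N x N) *)
Definition infinite_matrix_sigma : set (set (nat -> nat -> R)) :=
  family_sigma setT (fun (ij : nat * nat) y => y ij.1 ij.2).

(* the product (i.e. Borel) sigma-algebra on M_{p,q}(R) *)
Definition matrix_sigma (p q : nat) : set (set 'M[R]_(p, q)) :=
  family_sigma setT (fun (ab : 'I_p * 'I_q) (M : 'M[R]_(p, q)) => M ab.1 ab.2).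

End sigma_algebras.

Section probability_notions.
Context {d : measure_display} {Omega : measurableType d} {R : realType}.
Variable P : probability Omega R.
Local Open Scope ereal_scope.

Definition independent_systems (F G : set (set Omega)) : Prop :=
  forall A B, F A -> G B -> P (A `&` B) = P A * P B.

Definition mutually_independent (I : eqType) (X : I -> {RV P >-> R}) : Prop :=
  forall (s : seq I) (B : I -> set R), uniq s ->
    (forall i, measurable (B i)) ->
    P (\bigcap_(i in [set` s]) (X i @^-1` B i)) =
    \prod_(i <- s) P (X i @^-1` B i).

Definition cvg_in_probability (X : nat -> Omega -> R) (Z : Omega -> R) : Prop :=
  forall e : R, (0 < e)%R ->
    P [set w | (e < `|X N w - Z w|)%R] @[N --> \oo] --> 0.

(* Z is a version of E[X | S], i.e. of E[X | sigma(S)] *)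
Definition is_cond_expectation (X : Omega -> R) (S : {RV P >-> R})
    (Z : Omega -> R) : Prop :=
  [/\ P.-integrable setT (EFin \o Z),
      forall B : set R, measurable B -> g_sigma_algebra_preimage S (Z @^-1` B)
    & forall A, g_sigma_algebra_preimage S A ->
        \int[P]_(w in A) (Z w)%:E = \int[P]_(w in A) (X w)%:E].

(* A version of E[X | S], when X is integrable (is_cond_expectationP below);
   it is unique up to a P-null set. *)
Definition cond_expectation (X : Omega -> R) (S : {RV P >-> R}) : Omega -> R :=
  xget (cst 0%R) [set Z | is_cond_expectation X S Z].

Lemma is_cond_expectationP (X : Omega -> R) (S : {RV P >-> R}) :
  P.-integrable setT (EFin \o X) ->
  is_cond_expectation X S (cond_expectation X S).
Proof.
move=> iX; apply: xgetPex.
have mS : measurable_fun setT S by exact: measurable_funP.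
pose nu : {charge set Omega -> \bar R} := induced_charge iX.
pose nuS : {charge set R -> \bar R} :=
  measure_function_pushforward__canonical__charge_Charge nu mS.
pose muS : {sigma_finite_measure set R -> \bar R} := distribution P S.
have nu_dom : nu `<< P.
  apply/null_content_dominatesP => A mA PA0.
  apply: null_set_integral => //.
  by apply: (measurable_funS measurableT) => //; exact: measurable_int iX.
have dom : nuS `<< muS by exact: dominates_pushforward.
pose f : R -> \bar R := Radon_Nikodym nuS muS.
have ffin x : f x \is a fin_num by exact: Radon_Nikodym_fin_num.
have fint : muS.-integrable setT f by exact: Radon_Nikodym_integrable.
have mf := measurable_int _ fint.
have fE : EFin \o (fine \o f \o S) = f \o S.
  by apply/funext => w /=; rewrite fineK.
have intfS : P.-integrable setT (f \o S).
  apply/integrableP; split; first exact: (measurableT_comp mf mS).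
  have /integrableP[_] := fint.
  rewrite /muS /= ge0_integral_distribution//.
  exact: measurableT_comp.
exists (fine \o f \o S); split.
- by rewrite fE.
- move=> B mB; exists ((fine \o f) @^-1` B) => //.
    rewrite -[X in measurable X]setTI.
    by apply: (measurableT_comp _ mf) => //; exact: measurable_fine.
  by rewrite setTI.
- move=> _ [B mB <-]; rewrite setTI.
  have mSB : measurable (S @^-1` B).
    exact: measurable_funPTI.
  have := Radon_Nikodym_integral dom mB.
  rewrite /nuS /= /pushforward /nu /= /induced_charge => ->.
  rewrite -/f /muS /= /distribution integral_pushforward//.
    by apply: eq_integral => w _ /=; rewrite fineK.
  exact: integrableS intfS.
Qed.

End probability_notions.

Section rce.
Context {d : measure_display} {Omega : measurableType d} {R : realType}.
Variable P : probability Omega R.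

Definition finite_permutation (s : nat -> nat) : Prop :=
  bijective s /\ exists k, forall i, (k <= i)%N -> s i = i.

Definition row_column_exchangeable (Y : nat -> nat -> {RV P >-> R}) : Prop :=
  forall s1 s2 : nat -> nat, finite_permutation s1 -> finite_permutation s2 ->
  forall A, infinite_matrix_sigma A ->
    P [set w | A (fun i j => Y (s1 i) (s2 j) w)] =
    P [set w | A (fun i j => Y i j w)].

Definition dissociated (Y : nat -> nat -> {RV P >-> R}) : Prop :=
  forall m n : nat,
    independent_systems P
      (family_sigma [set ij : nat * nat | (ij.1 < m)%N /\ (ij.2 < n)%N]
         (fun ij => Y ij.1 ij.2))
      (family_sigma [set ij : nat * nat | (m <= ij.1)%N /\ (n <= ij.2)%N]
         (fun ij => Y ij.1 ij.2)).

Definition AHK_variables (xi eta : nat -> {RV P >-> R})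
    (zeta : nat -> nat -> {RV P >-> R}) (k : (nat + nat) + nat * nat) :
    {RV P >-> R} :=
  match k with
  | inl (inl i) => xi i
  | inl (inr j) => eta j
  | inr (i, j) => zeta i j
  end.

Record AHK_representation (Y : nat -> nat -> {RV P >-> R})
    (phi : R -> R -> R -> R) (xi eta : nat -> {RV P >-> R})
    (zeta : nat -> nat -> {RV P >-> R}) : Prop := {
  AHK_measurable :
    measurable_fun
      ((`[0, 1] : set R) `*` (`[0, 1] : set R) `*` (`[0, 1] : set R))
      (fun x : R * R * R => phi x.1.1 x.1.2 x.2);
  AHK_independent : mutually_independent (AHK_variables xi eta zeta);
  AHK_uniform : forall k (B : set R), measurable B ->
    distribution P (AHK_variables xi eta zeta k) B =
    uniform_prob (@ltr01 R) B;
  AHK_eq : forall i j,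
    {ae P, forall w, Y i j w = phi (xi i w) (eta j w) (zeta i j w)} }.

End rce.

Section kernels_and_estimators.
Context {R : realType} (p q : nat).

Record kernel_function (h : 'M[R]_(p, q) -> R) : Prop := {
  kernel_measurable : forall B : set R, measurable B ->
    matrix_sigma (h @^-1` B);
  kernel_invariant : forall (s : 'S_p) (t : 'S_q) (M : 'M[R]_(p, q)),
    h (row_perm s (col_perm t M)) = h M }.

Variable h : 'M[R]_(p, q) -> R.

(* Y_{[p],[q]} *)
Definition leading_submatrix (y : nat -> nat -> R) : 'M[R]_(p, q) :=
  \matrix_(a < p, b < q) y a b.

(* Y_{I,J}, the elements of I and J being taken in increasing order; used only
   for #|I| = p and #|J| = q. *)
Definition submatrix (y : nat -> nat -> R) (m n : nat)
    (I : {set 'I_m}) (J : {set 'I_n}) : 'M[R]_(p, q) :=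
  \matrix_(a < p, b < q)
    y (nth 0%N [seq val i | i <- enum I] a) (nth 0%N [seq val j | j <- enum J] b).

(* In the estimators y is the realised data matrix, m = m_N and n = n_N. *)

Definition mu_hat (y : nat -> nat -> R) (m n : nat) (i : 'I_m) : R :=
  'C(m.-1, p.-1)%:R^-1 * 'C(n, q)%:R^-1 *
  \sum_(I : {set 'I_m} | (#|I| == p) && (i \in I))
    \sum_(J : {set 'I_n} | #|J| == q) h (submatrix y I J).

Definition nu_hat (y : nat -> nat -> R) (m n : nat) (j : 'I_n) : R :=
  'C(m, p)%:R^-1 * 'C(n.-1, q.-1)%:R^-1 *
  \sum_(I : {set 'I_m} | #|I| == p)
    \sum_(J : {set 'I_n} | (#|J| == q) && (j \in J)) h (submatrix y I J).

Definition v10_hat (y : nat -> nat -> R) (m n : nat) : R :=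
  'C(m, 2)%:R^-1 *
  \sum_(i1 < m) \sum_(i2 < m | (i1 < i2)%N)
    (mu_hat y n i1 - mu_hat y n i2) ^+ 2 / 2.

Definition v01_hat (y : nat -> nat -> R) (m n : nat) : R :=
  'C(n, 2)%:R^-1 *
  \sum_(j1 < n) \sum_(j2 < n | (j1 < j2)%N)
    (nu_hat y m j1 - nu_hat y m j2) ^+ 2 / 2.

Definition combine_variances (rho v10 v01 : R) : R :=
  p%:R ^+ 2 / rho * v10 + q%:R ^+ 2 / (1 - rho) * v01.

Definition V_hat (rho : R) (y : nat -> nat -> R) (m n : nat) : R :=
  combine_variances rho (v10_hat y m n) (v01_hat y m n).

End kernels_and_estimators.

Section asymptotic_variance.
Context {d : measure_display} {Omega : measurableType d} {R : realType}.
Variable P : probability Omega R.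
Variables (p q : nat) (h : 'M[R]_(p, q) -> R).
Variable Y : nat -> nat -> {RV P >-> R}.

Definition h_leading (w : Omega) : R :=
  h (leading_submatrix p q (fun i j => Y i j w)).

Definition v10 (xi : nat -> {RV P >-> R}) : R :=
  fine 'V_P[cond_expectation h_leading (xi 0%N)].

Definition v01 (eta : nat -> {RV P >-> R}) : R :=
  fine 'V_P[cond_expectation h_leading (eta 0%N)].

Definition V_asymptotic (rho : R) (xi eta : nat -> {RV P >-> R}) : R :=
  combine_variances p q rho (v10 xi) (v01 eta).

End asymptotic_variance.

(* Main.v *)
Require Import Defs.
From HB Require Import structures.
From mathcomp Require Import all_boot all_order perm all_algebra.
From mathcomp Require Import all_classical all_reals all_analysis.
From mathcomp Require Import measurable_realfun ring lra zify.

(* For i in I and i in I', the kernels h(Y_{I,J}) and h(Y_{I',J'}) are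
   conditionally independent given xi_i as soon as I and I' meet only in i and J,
   J' are disjoint.  With g(xi_i) = E[h | xi_i], the variables
   h(Y_{I,J}) - g(xi_i) are then orthogonal for such pairs, and the proportion of
   the other pairs is O(1/m + 1/n); hence mu_hat^(i) - g(xi_i) tends to 0 in L^2,
   uniformly in i.  The estimator v10_hat is the empirical variance of the
   mu_hat^(i); empirical variance is a quadratic form, so it is close in mean to
   that of the g(xi_i), and, after truncation of g, the law of large numbers in
   L^2 for bounded i.i.d. variables gives the limit Var g(xi_1).  The column
   estimator is the row estimator of the transposed kernel and matrix. *)

Set Implicit Arguments.
Unset Strict Implicit.
Unset Printing Implicit Defensive.

Import Order.TTheory GRing.Theory Num.Theory.
Import numFieldNormedType.Exports.

Local Open Scope ring_scope.

(** * Counting overlapping index sets *)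

(** Only second moments of h are available, and this decides the tools. The squares of g(xi_i) are
    merely integrable, so no L^2 law of large numbers applies to them directly: hence the
    truncation. Limits are taken in L^1, where errors add up as explicit bounds; Markov's inequality
    enters once, at the end. All comparisons of two empirical variances rest on |b^2 - a^2| <= t a^2
    + (1 + 1/t) (b - a)^2, with t > 0 free. The conditional expectation in [v10] is an arbitrary
    version, known only up to null sets. It is replaced by an explicit function of xi_1, obtained by
    integrating out the other AHK variables with Fubini. That function depends only on the law of a
    p x q block, so the same g serves every row i and every choice of the other indices. *)

Section counting.
Local Open Scope nat_scope.
Variable T : finType.
Implicit Types (B I : {set T}) (i a : T).

(** Pascal's rule: a p-subset of B either contains [i] or lies in B minus [i]. The ambient set B is
    a parameter because [mul_card_draws_mem2] removes a point from the whole type. *)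
Lemma card_draws_mem B i p : 0 < p -> i \in B ->
  #|[set I : {set T} | (I \subset B) && (#|I| == p) && (i \in I)]| =
  'C(#|B|.-1, p.-1).
Proof.
move=> p0 iB.
have := cardsID [set I : {set T} | i \in I] [set I : {set T} | I \subset B & #|I| == p].
rewrite cards_draws (_ : _ :\: _ = [set I : {set T} | I \subset B :\ i & #|I| == p]).
  rewrite cards_draws (cardsD1 i B) iB add1n /= [B :\ i]lock.
  have binE N : 'C(N.+1, p) = 'C(N, p) + 'C(N, p.-1) by rewrite -(prednK p0) binS.
  rewrite binE addnC => /addnI <-.
  by apply: eq_card => I; rewrite !inE.
by apply/setP => I; rewrite !inE subsetD1; do !case: (_ \subset _); case: (_ \in _); case: eqP.
Qed.

Lemma card_draws_mem1 i p : 0 < p ->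
  #|[set I : {set T} | (#|I| == p) && (i \in I)]| = 'C(#|T|.-1, p.-1).
Proof.
move=> p0; rewrite -cardsT -(card_draws_mem (i := i) p0)//.
by apply: eq_card => I; rewrite !inE finset.subsetT.
Qed.

Lemma mul_card_draws_mem1 i p : 0 < p ->
  #|T| * #|[set I : {set T} | (#|I| == p) && (i \in I)]| = p * 'C(#|T|, p).
Proof.
by move=> p0; rewrite card_draws_mem1//; case: p p0 => // p _; exact: mul_bin_diag.
Qed.

(** Once I contains i, its other p-1 elements are a uniform draw from |T|-1 points, so a lies in I
    with frequency (p-1)/(|T|-1). The proof counts the sets that avoid a; the product form avoids
    division in nat. *)
Lemma mul_card_draws_mem2 i a p : 0 < p -> a != i ->
  #|T|.-1 * #|[set I : {set T} | (#|I| == p) && (i \in I) && (a \in I)]| =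
  p.-1 * #|[set I : {set T} | (#|I| == p) && (i \in I)]|.
Proof.
move=> p0 ai.
have := cardsID [set I : {set T} | a \in I] [set I : {set T} | (#|I| == p) && (i \in I)].
rewrite (_ : _ :\: _ =
  [set I : {set T} | (I \subset [set: T] :\ a) && (#|I| == p) && (i \in I)]);
  last by apply/setP => I; rewrite !inE subsetD1 finset.subsetT andbA.
have cardCa : #|[set: T] :\ a| = #|T|.-1.
  by rewrite -cardsT [in RHS](cardsD1 a) finset.in_setT.
rewrite card_draws_mem ?cardCa ?inE 1?eq_sym ?ai//.
rewrite (_ : _ :&: _ = [set I : {set T} | (#|I| == p) && (i \in I) && (a \in I)]);
  last by apply/setP => I; rewrite !inE.
rewrite card_draws_mem1//.
set k := #|_|; have := mul_bin_down #|T|.-1 p.-1.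
(* [mul_bin_down] contains a truncated subtraction, which is exact only for p-1 <= |T|-1; beyond
   that the binomials vanish. *)
have [pT|pT] := leqP p.-1 #|T|.-1; last first.
  by rewrite (bin_small pT) => _ /eqP; rewrite addn_eq0 => /andP[/eqP-> _]; rewrite !muln0.
move: pT 'C(_, _) 'C(_, _) => pT c' c; nia.
Qed.

End counting.

Section overlap.
Variables (R : realFieldType) (m n p q : nat) (i : 'I_m).
Hypotheses (p_gt0 : (0 < p)%N) (q_gt0 : (0 < q)%N).
Hypotheses (p_le_m : (p <= m)%N) (q_le_n : (q <= n)%N) (m_gt1 : (1 < m)%N).
Local Notation pair := ({set 'I_m} * {set 'I_n})%type.

Definition index_pair : pred pair :=
  fun A => (#|A.1| == p) && (i \in A.1) && (#|A.2| == q).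

(** The row i is common to all index pairs and is absorbed by conditioning on xi_i, so only other
    common rows count, whereas any common column does. *)
Definition overlap (A B : pair) : bool :=
  [exists a, [&& a != i, a \in A.1 & a \in B.1]] ||
  [exists b, (b \in A.2) && (b \in B.2)].

Definition pair_weight : R := 'C(m.-1, p.-1)%:R^-1 * 'C(n, q)%:R^-1.

Lemma sum_index_pair (F : {set 'I_m} -> R) (G : {set 'I_n} -> R) :
  \sum_(A | index_pair A) F A.1 * G A.2 =
  (\sum_(I : {set 'I_m} | (#|I| == p) && (i \in I)) F I) *
  (\sum_(J : {set 'I_n} | #|J| == q) G J).
Proof.
rewrite -(pair_big (fun I : {set 'I_m} => (#|I| == p) && (i \in I))
  (fun J : {set 'I_n} => #|J| == q) (fun I J => F I * G J)) /=.
by rewrite mulr_suml; apply: eq_bigr => I _; rewrite mulr_sumr.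
Qed.

Lemma sum_indicator (U : finType) (C D : pred U) :
  \sum_(x | C x) (D x)%:R = #|[set x | C x && D x]|%:R :> R.
Proof.
rewrite -sum1_card natr_sum big_mkcond [RHS]big_mkcond/=.
by apply: eq_bigr => x _; rewrite inE; case: (C x); case: (D x).
Qed.

Let bin_neq0 : ('C(m.-1, p.-1)%:R != 0 :> R) /\ ('C(n, q)%:R != 0 :> R).
Proof. by rewrite !pnatr_eq0 -!lt0n !bin_gt0; split=> //; lia. Qed.

Lemma card_rows : #|[set I : {set 'I_m} | (#|I| == p) && (i \in I)]| = 'C(m.-1, p.-1).
Proof. by rewrite card_draws_mem1// card_ord. Qed.

Lemma card_columns : #|[set J : {set 'I_n} | #|J| == q]| = 'C(n, q).
Proof. by rewrite -[X in 'C(X, _)]card_ord -(card_draws 'I_n q). Qed.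

Lemma sum1_index_pair : pair_weight * \sum_(A | index_pair A) 1 = 1.
Proof.
have -> : \sum_(A | index_pair A) (1 : R) = 'C(m.-1, p.-1)%:R * 'C(n, q)%:R.
  rewrite -card_rows -card_columns !cardsE -!sumr_const -sum_index_pair.
  by apply: eq_bigr => A _; rewrite mul1r.
have [mp nq] := bin_neq0.
by rewrite /pair_weight mulrACA !mulVf// mulr1.
Qed.

Lemma row_incidence a : a != i ->
  pair_weight * \sum_(A | index_pair A) (a \in A.1)%:R = p.-1%:R / m.-1%:R.
Proof.
move=> ai.
have -> : \sum_(A | index_pair A) ((a \in A.1)%:R : R) =
    #|[set I : {set 'I_m} | (#|I| == p) && (i \in I) && (a \in I)]|%:R * 'C(n, q)%:R.
  rewrite -sum_indicator -card_columns cardsE -sumr_const.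
  rewrite -(sum_index_pair (fun I => (a \in I)%:R)).
  by apply: eq_bigr => A _; rewrite mulr1.
have := mul_card_draws_mem2 p_gt0 ai; rewrite card_rows card_ord.
move=> /(congr1 (fun k => k%:R : R)); rewrite !natrM => H.
have [mp nq] := bin_neq0.
have m0 : m.-1%:R != 0 :> R by rewrite pnatr_eq0; lia.
apply: (mulfI m0); rewrite /pair_weight [RHS]mulrC divfK//.
by rewrite mulrACA mulVf// mulr1 mulrCA H mulrCA mulVf// mulr1.
Qed.

Lemma column_incidence b :
  pair_weight * \sum_(A | index_pair A) (b \in A.2)%:R = q%:R / n%:R.
Proof.
have -> : \sum_(A | index_pair A) ((b \in A.2)%:R : R) =
    'C(m.-1, p.-1)%:R * #|[set J : {set 'I_n} | (#|J| == q) && (b \in J)]|%:R.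
  rewrite -sum_indicator -card_rows cardsE -sumr_const.
  rewrite -(sum_index_pair _ (fun J => (b \in J)%:R)).
  by apply: eq_bigr => A _; rewrite mul1r.
have := mul_card_draws_mem1 b q_gt0; rewrite card_ord.
move=> /(congr1 (fun k => k%:R : R)); rewrite !natrM => H.
have [mp nq] := bin_neq0.
have n0 : n%:R != 0 :> R by rewrite pnatr_eq0; lia.
apply: (mulfI n0); rewrite /pair_weight [RHS]mulrC divfK//.
by rewrite mulrACA mulVf// mul1r mulrCA H mulrCA mulVf// mulr1.
Qed.

(** A union bound over the common element, written with products of indicators so that the double
    sum over A and B factors. *)
Lemma overlap_le A B : (overlap A B)%:R <=
  \sum_(a | a != i) (a \in A.1)%:R * (a \in B.1)%:R +
  \sum_b (b \in A.2)%:R * (b \in B.2)%:R :> R.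
Proof.
have s1 : 0 <= \sum_(a | a != i) (a \in A.1)%:R * (a \in B.1)%:R :> R.
  by apply: sumr_ge0 => a _; rewrite mulr_ge0.
have s2 : 0 <= \sum_b (b \in A.2)%:R * (b \in B.2)%:R :> R.
  by apply: sumr_ge0 => b _; rewrite mulr_ge0.
have [|_] := boolP (overlap A B); last exact: addr_ge0.
case/orP => /existsP[x].
  case/and3P => xi xA xB; apply: ler_wpDr => //.
  rewrite (bigD1 x)//= xA xB mulr1 lerDl; apply: sumr_ge0 => a _.
  by rewrite mulr_ge0.
case/andP => xA xB; apply: ler_wpDl => //.
rewrite (bigD1 x)//= xA xB mulr1 lerDl; apply: sumr_ge0 => a _.
by rewrite mulr_ge0.
Qed.

(** For two independent uniform index pairs, this bounds the probability of overlap by the expected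
    number of common elements: (m-1) ((p-1)/(m-1))^2 for the rows other than i, plus n (q/n)^2 for
    the columns. *)
Lemma overlap_bound :
  pair_weight ^+ 2 *
    (\sum_(A | index_pair A) \sum_(B | index_pair B) (overlap A B)%:R) <=
  p.-1%:R ^+ 2 / m.-1%:R + q%:R ^+ 2 / n%:R.
Proof.
have w0 : 0 <= pair_weight by rewrite mulr_ge0// invr_ge0.
(* Summing over the common element last turns the count of pairs (A, B) into a sum of squared
   incidence counts. *)
have exch (I : finType) (J : pred I) (D : I -> pair -> bool) :
  \sum_(A | index_pair A) \sum_(B | index_pair B)
     \sum_(a | J a) ((D a A)%:R * (D a B)%:R : R) =
  \sum_(a | J a) (\sum_(A | index_pair A) (D a A)%:R) ^+ 2.
  under eq_bigr do rewrite exchange_big/=.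
  rewrite exchange_big/=; apply: eq_bigr => a _.
  by rewrite expr2 mulr_suml; apply: eq_bigr => A _; rewrite mulr_sumr.
apply: (@le_trans _ _ (pair_weight ^+ 2 *
   (\sum_(a | a != i) (\sum_(A | index_pair A) (a \in A.1)%:R) ^+ 2 +
    \sum_b (\sum_(A | index_pair A) (b \in A.2)%:R) ^+ 2))).
  apply: ler_wpM2l; first exact: exprn_ge0.
  rewrite -(exch _ (fun a => a != i) (fun a A => a \in A.1)).
  rewrite -(exch _ predT (fun b A => b \in A.2)) -big_split/=.
  apply: ler_sum => A _; rewrite -big_split/=; apply: ler_sum => B _.
  exact: overlap_le.
rewrite mulrDr !mulr_sumr lerD//.
  rewrite (eq_bigr (fun=> (p.-1%:R / m.-1%:R) ^+ 2)); last first.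
    by move=> a ai; rewrite -exprMn row_incidence.
  rewrite sumr_const (_ : #|_| = m.-1); last by rewrite cardC1 card_ord.
  have m0 : m.-1%:R != 0 :> R by rewrite pnatr_eq0; lia.
  by rewrite -mulr_natr le_eqVlt; apply/orP; left; apply/eqP; field.
rewrite (eq_bigr (fun=> (q%:R / n%:R) ^+ 2)); last first.
  by move=> a _; rewrite -exprMn column_incidence.
rewrite sumr_const card_ord.
have n0 : n%:R != 0 :> R by rewrite pnatr_eq0; lia.
by rewrite -mulr_natr le_eqVlt; apply/orP; left; apply/eqP; field.
Qed.

End overlap.

Local Open Scope classical_set_scope.
Local Open Scope ring_scope.

(** * Square-integrable random variables *)

Section square_integrable.
Context {d : measure_display} {T : measurableType d} {R : realType}.
Variable P : probability T R.
Implicit Types f g : T -> R.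

Local Notation L1 f := (P.-integrable setT (EFin \o f)).
Local Notation E f := (Rintegral P setT f).

Lemma L1_measurable f : L1 f -> measurable_fun setT f.
Proof. by move=> /measurable_int/measurable_EFinP. Qed.

Lemma L1_dominated f g : measurable_fun setT f -> L1 g ->
  (forall x, `|f x| <= g x) -> L1 f.
Proof.
move=> mf ig fg; apply: (le_integrable measurableT _ _ ig).
  exact/measurable_EFinP.
by move=> x _ /=; rewrite lee_fin (le_trans (fg x))// ler_norm.
Qed.

Lemma eq_L1 f g : f =1 g -> L1 f -> L1 g.
Proof. by move=> /funext ->. Qed.

Lemma eq_E f g : f =1 g -> E f = E g.
Proof. by move=> /funext ->. Qed.

Lemma L1_cst c : L1 (fun _ => c).
Proof. exact: finite_measure_integrable_cst. Qed.

Lemma L1D f g : L1 f -> L1 g -> L1 (fun x => f x + g x).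
Proof. by move=> If Ig; apply: eq_integrable (integrableD measurableT If Ig). Qed.

Lemma L1Zl c f : L1 f -> L1 (fun x => c * f x).
Proof. by move=> If; apply: eq_integrable (integrableZl measurableT c If). Qed.

Lemma L1B f g : L1 f -> L1 g -> L1 (fun x => f x - g x).
Proof. by move=> If Ig; apply: eq_integrable (integrableB measurableT If Ig). Qed.

Lemma L1_norm f : L1 f -> L1 (fun x => `|f x|).
Proof. by move=> If; apply: eq_integrable (integrable_abse If). Qed.

Lemma L1_sum (I : Type) (s : seq I) (Q : pred I) (F : I -> T -> R) :
  (forall i, Q i -> L1 (F i)) -> L1 (fun x => \sum_(i <- s | Q i) F i x).
Proof.
move=> IF; elim: s => [|i s IH].
  by apply: eq_L1 (L1_cst 0) => x; rewrite big_nil.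
have [Qi|Qi] := boolP (Q i); last first.
  by apply: eq_L1 IH => x; rewrite big_cons (negbTE Qi).
by apply: eq_L1 (L1D (IF _ Qi) IH) => x; rewrite big_cons Qi.
Qed.

Lemma ED f g : L1 f -> L1 g -> E (fun x => f x + g x) = E f + E g.
Proof. exact: RintegralD. Qed.

Lemma EB f g : L1 f -> L1 g -> E (fun x => f x - g x) = E f - E g.
Proof. exact: RintegralB. Qed.

Lemma EZl c f : L1 f -> E (fun x => c * f x) = c * E f.
Proof. exact: RintegralZl. Qed.

Lemma E_cst c : E (fun _ => c) = c.
Proof. by rewrite /Rintegral integral_cst//= probability_setT mule1. Qed.

Lemma E_sum (I : Type) (s : seq I) (Q : pred I) (F : I -> T -> R) :
  (forall i, Q i -> L1 (F i)) ->
  E (fun x => \sum_(i <- s | Q i) F i x) = \sum_(i <- s | Q i) E (F i).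
Proof.
move=> IF; elim: s => [|i s IH].
  by rewrite big_nil -[RHS](E_cst 0); apply: eq_E => x; rewrite big_nil.
rewrite big_cons -IH; case: ifPn => Qi.
  rewrite -ED; [|exact: IF|exact: L1_sum].
  by apply: eq_E => x; rewrite big_cons Qi.
by apply: eq_E => x; rewrite big_cons (negbTE Qi).
Qed.

Lemma E_le f g : L1 f -> L1 g -> (forall x, f x <= g x) -> E f <= E g.
Proof. by move=> If Ig fg; apply: le_Rintegral. Qed.

Lemma E_ge0 f : (forall x, 0 <= f x) -> 0 <= E f.
Proof. by move=> f0; apply: Rintegral_ge0. Qed.

Lemma E_norm f : L1 f -> `|E f| <= E (fun x => `|f x|).
Proof. exact: le_normr_Rintegral. Qed.

Lemma EFin_E f : L1 f -> (E f)%:E = (\int[P]_x (f x)%:E)%E.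
Proof. by move=> If; rewrite fineK//; exact: integrable_fin_num. Qed.

Lemma E_ae f g : measurable_fun setT f -> measurable_fun setT g ->
  {ae P, forall x, f x = g x} -> E f = E g.
Proof.
move=> mf mg fg; congr fine; apply: ae_eq_integral => //.
- exact/measurable_EFinP.
- exact/measurable_EFinP.
- by apply: filterS fg => x -> _.
Qed.

Definition sqint f :=
  measurable_fun setT f /\ L1 (fun x => f x ^+ 2).

Lemma eq_sqint f g : f =1 g -> sqint f -> sqint g.
Proof. by move=> /funext ->. Qed.

Lemma sqint_bounded f M : measurable_fun setT f ->
  (forall x, `|f x| <= M) -> sqint f.
Proof.
move=> mf fM; split => //.
apply: (@L1_dominated _ (fun _ => M ^+ 2)) (L1_cst _) _.
  exact: measurable_funX.
move=> x; rewrite normrX lerXn2r// ?nnegrE// (le_trans _ (fM x))//.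
Qed.

Lemma sqint_cst c : sqint (fun _ => c).
Proof. by apply: (@sqint_bounded _ `|c|). Qed.

Lemma sqintM_L1 f g : sqint f -> sqint g -> L1 (fun x => f x * g x).
Proof.
move=> [mf If] [mg Ig].
apply: (@L1_dominated _ (fun x => f x ^+ 2 + g x ^+ 2)) (L1D If Ig) _.
  exact: measurable_funM.
move=> x; rewrite ler_norml; apply/andP; split; nra.
Qed.

Lemma sqint_L1 f : sqint f -> L1 f.
Proof.
by move=> /(sqintM_L1 (sqint_cst 1)); apply: eq_L1 => x; rewrite mul1r.
Qed.

Lemma sqintD f g : sqint f -> sqint g -> sqint (fun x => f x + g x).
Proof.
move=> sf sg; have fg := sqintM_L1 sf sg.
case: sf sg => mf If [mg Ig]; split; first exact: measurable_funD.
apply: eq_L1 (L1D (L1D If (L1Zl 2 fg)) Ig) => x.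
by rewrite sqrrD mulr_natl.
Qed.

Lemma sqintZl c f : sqint f -> sqint (fun x => c * f x).
Proof.
move=> [mf If]; split; first exact: measurable_funM.
by apply: eq_L1 (L1Zl (c ^+ 2) If) => x; rewrite exprMn.
Qed.

Lemma sqintB f g : sqint f -> sqint g -> sqint (fun x => f x - g x).
Proof.
move=> sf /(sqintZl (-1)) sg.
by apply: eq_sqint (sqintD sf sg) => x; rewrite mulN1r.
Qed.

Lemma sqint_sum (I : Type) (s : seq I) (Q : pred I) (F : I -> T -> R) :
  (forall i, Q i -> sqint (F i)) -> sqint (fun x => \sum_(i <- s | Q i) F i x).
Proof.
move=> sF; elim: s => [|i s IH].
  by apply: eq_sqint (sqint_cst 0) => x; rewrite big_nil.
have [Qi|Qi] := boolP (Q i); last first.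
  by apply: eq_sqint IH => x; rewrite big_cons (negbTE Qi).
by apply: eq_sqint (sqintD (sF _ Qi) IH) => x; rewrite big_cons Qi.
Qed.

Lemma E_sqr_sum (I : Type) (s : seq I) (Q : pred I) (F : I -> T -> R) :
  (forall i, Q i -> sqint (F i)) ->
  E (fun x => (\sum_(i <- s | Q i) F i x) ^+ 2) =
  \sum_(i <- s | Q i) \sum_(j <- s | Q j) E (fun x => F i x * F j x).
Proof.
move=> sF; transitivity
  (E (fun x => \sum_(i <- s | Q i) \sum_(j <- s | Q j) F i x * F j x)).
  apply: eq_E => x; rewrite expr2 big_distrl/=.
  by apply: eq_bigr => i _; rewrite big_distrr.
rewrite E_sum; last first.
  by move=> i Qi; apply: L1_sum => j Qj; exact: sqintM_L1 (sF _ Qi) (sF _ Qj).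
by apply: eq_bigr => i Qi; rewrite E_sum// => j Qj; apply: sqintM_L1; exact: sF.
Qed.

(** Since both second moments have the same bound M, 2fg <= f^2 + g^2 does the work of
    Cauchy-Schwarz. *)
Lemma E_mul_bound f g M : sqint f -> sqint g ->
  E (fun x => f x ^+ 2) <= M -> E (fun x => g x ^+ 2) <= M ->
  E (fun x => f x * g x) <= M.
Proof.
move=> sf sg fM gM.
have : E (fun x => f x * g x) <= E (fun x => 2^-1 * (f x ^+ 2 + g x ^+ 2)).
  apply: E_le => [||x]; [exact: sqintM_L1| |].
    by apply: L1Zl; apply: L1D; [exact: sf.2|exact: sg.2].
  have := sqr_ge0 (f x - g x); rewrite sqrrB; lra.
rewrite EZl ?ED; [|exact: sf.2|exact: sg.2|by apply: L1D; [exact: sf.2|exact: sg.2]].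
lra.
Qed.

End square_integrable.

(** * Independence *)

Section pi_systems.
Context {d : measure_display} {T : measurableType d} {R : realType}.
Variable P : probability T R.
Local Open Scope ereal_scope.

(** For fixed B, the finite measures P(. [&] B) and P(B) P agree on the pi-system F, hence on the
    sigma-algebra it generates. [independent_pi] applies this to each side in turn. *)
Lemma independent_pi_l (F : set (set T)) (B : set T) :
  setI_closed F -> F setT -> F `<=` measurable -> measurable B ->
  (forall A, F A -> P (A `&` B) = P A * P B) ->
  forall A, <<s F >> A -> P (A `&` B) = P A * P B.
Proof.
move=> FI FT Fm mB FB A sFA.
have PB0 : (0 <= fine (P B))%R by rewrite fine_ge0.
have PBE : (fine (P B))%:E = P B by rewrite fineK// fin_num_measure.
have := @g_sigma_algebra_measure_unique _ R _ F Fm (fun _ => setT) (fun _ => FT).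
move/(_ (bigcup_const _ _) (mrestr P mB) (mscale (NngNum PB0) P) FI) => /=.
rewrite /mrestr /mscale /= PBE => -> //.
- by rewrite muleC.
- by move=> C FC; rewrite FB// muleC.
- by move=> _; rewrite setTI (le_lt_trans (probability_le1 _ mB))// ltry.
Qed.

Lemma independent_pi (F G : set (set T)) :
  setI_closed F -> F setT -> F `<=` measurable ->
  setI_closed G -> G setT -> G `<=` measurable ->
  independent_systems P F G -> independent_systems P <<s F >> <<s G >>.
Proof.
move=> FI FT Fm GI GT Gm FG A B sFA sGB.
have sm (H : set (set T)) : H `<=` measurable -> <<s H >> `<=` measurable.
  by move=> Hm; apply: smallest_sub => //; exact: sigma_algebra_measurable.
rewrite setIC muleC; apply: (@independent_pi_l G) => //; first exact: sm sFA.
move=> C GC; rewrite setIC muleC; apply: (@independent_pi_l F) => //.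
  exact: Gm.
by move=> D FD; exact: FG.
Qed.

Lemma eq_law_pi d' (T' : measurableType d') (U V : {mfun T >-> T'})
    (G : set (set T')) :
  measurable = <<s G >> -> setI_closed G -> G setT ->
  (forall A, G A -> P (U @^-1` A) = P (V @^-1` A)) ->
  forall A, measurable A -> P (U @^-1` A) = P (V @^-1` A).
Proof.
move=> mG GI GT UV A mA.
apply: (@measure_unique _ R T' G (fun _ => setT) mG GI (fun _ => GT) _
  (distribution P U) (distribution P V)) => //.
- by rewrite bigcup_const.
- move=> _; apply: le_lt_trans (probability_le1 (distribution P U) measurableT) _.
  exact: ltry.
Qed.

End pi_systems.

Section coordinate_space.
Context {R : realType} (L : Type).

Definition coordinate_preimages : set (set (L -> R)) :=
  \bigcup_(l in setT) preimage_set_system setT (fun u : L -> R => u l) measurable.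

(** The alias equips L -> R with its product sigma-algebra, so that a whole block of variables is
    one random element, with a law to which Fubini applies. *)
Definition coord_space := g_sigma_algebraType coordinate_preimages.

Lemma measurable_coord (l : L) :
  measurable_fun setT (fun u : coord_space => (u l : R)).
Proof.
move=> _ B mB; apply: sub_sigma_algebra; exists l => //; exists B => //.
Qed.

Lemma measurable_into_coord_space d (T : measurableType d) (f : T -> coord_space) :
  (forall l, measurable_fun setT (fun t => f t l)) -> measurable_fun setT f.
Proof.
move=> mf; refine (@measurability _ _ T coord_space setT f coordinate_preimages erefl _).
move=> _ [_ [l _ [B mB <-]] <-]; rewrite !setTI.
by have := mf l measurableT B mB; rewrite setTI.
Qed.

End coordinate_space.
Arguments coord_space : clear implicits.

Section finite_coordinates.
Context {R : realType} (L : finType).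
Local Notation space := (coord_space R L).

Definition boxes : set (set space) :=
  [set [set u : space | forall l, A l (u l)] |
    A in [set A : L -> set R | forall l, measurable (A l)]].

Lemma boxes_setT : boxes setT.
Proof. by exists (fun _ => setT) => //; apply/seteqP; split. Qed.

Lemma boxes_setI : setI_closed boxes.
Proof.
move=> _ _ [A mA <-] [B mB <-]; exists (fun l => A l `&` B l).
  by move=> l; exact: measurableI.
apply/seteqP; split=> u /=; first by move=> AB; split=> l; case: (AB l).
by move=> [Au Bu] l; split; [exact: Au|exact: Bu].
Qed.

Lemma measurable_box (A : L -> set R) : (forall l, measurable (A l)) ->
  measurable ([set u | forall l, A l (u l)] : set space).
Proof.
move=> mA.
rewrite (_ : mkset _ = \big[setI/setT]_(l : L) ((fun u : space => u l) @^-1` A l)).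
  apply: bigsetI_measurable => l _.
  by rewrite -[X in measurable X]setTI; exact: measurable_coord.
rewrite -bigcap_seq; apply/seteqP; split=> [u Au l _|u Au l]; first exact: Au.
by apply: Au; rewrite /= mem_index_enum.
Qed.

Lemma measurable_boxesE : @measurable _ space = <<s boxes >>.
Proof.
apply/seteqP; split; apply: smallest_sub; try exact: smallest_sigma_algebra.
- move=> _ [l _ [B mB <-]]; apply: sub_sigma_algebra.
  (* The implication encodes B at coordinate l and the whole line at every other coordinate. *)
  exists (fun k => [set x | k = l -> B x]).
    move=> k; have [->|kl] := eqVneq k l.
      rewrite (_ : mkset _ = B)//; apply/seteqP; split => x; first exact.
      by move=> ? _.
    rewrite (_ : mkset _ = setT)//; apply/seteqP; split => x //= _ kE.
    by rewrite kE eqxx in kl.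
  apply/seteqP; split => u /=; first by move=> /(_ l erefl).
  by move=> [_ Bul] k ->.
- by move=> _ [A mA <-]; exact: measurable_box.
Qed.

End finite_coordinates.

Section families.
Context {d : measure_display} {Omega : measurableType d} {R : realType}.
Variable P : probability Omega R.

Lemma measurable_RV_preimage (X : {RV P >-> R}) (B : set R) :
  measurable B -> measurable (X @^-1` B).
Proof. by move=> mB; exact: measurable_funPTI. Qed.

Lemma mutually_independent_comp (I J : eqType) (X : I -> {RV P >-> R})
    (f : J -> I) :
  injective f -> mutually_independent X -> mutually_independent (X \o f).
Proof.
move=> fI indX s B us mB.
(* By injectivity this is [B j] at [f j]; off the image of f the condition is vacuous and gives the
   whole line. *)
pose B' i := [set x | forall j, f j = i -> B j x].
have B'f j : B' (f j) = B j.
  by apply/seteqP; split => x /=; [exact|move=> Bx k /fI ->].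
have mB' i : measurable (B' i).
  have [[j <-]|nji] := pselect (exists j, f j = i); first by rewrite B'f.
  rewrite (_ : B' i = setT)//; apply/seteqP; split => x //= _ j ji.
  by exfalso; apply: nji; exists j.
have := indX (map f s) B'; rewrite map_inj_uniq// big_map => /(_ us mB').
under eq_bigr do rewrite B'f.
move=> <-; congr (P _); apply/seteqP; split => w /= Bw.
  by move=> _ /mapP[j js ->] /=; rewrite B'f; exact: Bw.
by move=> j js /=; rewrite -B'f; apply: Bw; exact: map_f.
Qed.

(** Independence makes the probability of a box the product of the marginal ones, and boxes form a
    generating pi-system. *)
Lemma same_law (L : finType) (X X' : L -> {RV P >-> R}) :
  mutually_independent X -> mutually_independent X' ->
  (forall l B, measurable B -> P (X l @^-1` B) = P (X' l @^-1` B)) ->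
  forall A : set (coord_space R L), measurable A ->
  P ((fun w l => X l w) @^-1` A) = P ((fun w l => X' l w) @^-1` A).
Proof.
move=> indX indX' XX' A mA.
have mU (Z : L -> {RV P >-> R}) :
    measurable_fun setT ((fun w l => Z l w) : Omega -> coord_space R L).
  by apply: measurable_into_coord_space => l; exact: measurable_funP.
pose U : {mfun Omega >-> coord_space R L} := mfun_Sub (mem_set (mU X)).
pose U' : {mfun Omega >-> coord_space R L} := mfun_Sub (mem_set (mU X')).
have boxE (Z : L -> {RV P >-> R}) (B : L -> set R) : mutually_independent Z ->
    (forall l, measurable (B l)) ->
    P ((fun w l => Z l w) @^-1` [set u | forall l, B l (u l)]) =
    (\prod_l P (Z l @^-1` B l))%E.
  move=> indZ mB; rewrite -(indZ _ B (index_enum_uniq L) mB).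
  congr (P _); apply/seteqP; split => w /= Bw l; first by move=> _; exact: Bw.
  by apply: Bw; exact: mem_index_enum.
apply: (@eq_law_pi _ _ _ P _ _ U U' _ (measurable_boxesE L)) => //.
- exact: boxes_setI.
- exact: boxes_setT.
- move=> _ [B mB <-]; rewrite /= !boxE//; apply: eq_bigr => l _; exact: XX'.
Qed.

Lemma independent_blocks (I : eqType) (X : I -> {RV P >-> R}) (s1 s2 : seq I) :
  uniq (s1 ++ s2) -> mutually_independent X ->
  independent_systems P (family_sigma [set` s1] X) (family_sigma [set` s2] X).
Proof.
move=> us indX.
pose blocks (s : seq I) : set (set Omega) :=
  [set \bigcap_(i in [set` s]) (X i @^-1` B i) |
   B in [set B : I -> set R | forall i, measurable (B i)]].
have blocksT s : blocks s setT.
  by exists (fun _ => setT) => //; apply/seteqP; split.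
have blocksI s : setI_closed (blocks s).
  move=> _ _ [A mA <-] [B mB <-]; exists (fun i => A i `&` B i).
    by move=> i; exact: measurableI.
  by rewrite -bigcapI; apply: eq_bigcapr => i _; rewrite preimage_setI.
have blocksm s : blocks s `<=` measurable.
  move=> _ [B mB <-]; elim: s => [|i s IHs].
    by rewrite (_ : bigcap _ _ = setT)//; apply/seteqP; split.
  rewrite (_ : bigcap _ _ =
    X i @^-1` B i `&` \bigcap_(j in [set` s]) (X j @^-1` B j)).
    by apply: measurableI => //; exact: measurable_RV_preimage.
  apply/seteqP; split => w /=.
    move=> Bw; split=> [|j js]; apply: Bw => /=; rewrite ?mem_head//.
    by rewrite inE js orbT.
  by move=> [Bw Bsw] j /=; rewrite inE => /predU1P[->//|]; exact: Bsw.
have sub s : family_sigma [set` s] X `<=` <<s blocks s >>.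
  apply: smallest_sub; first exact: smallest_sigma_algebra.
  move=> _ [i /= si [B mB <-]]; apply: sub_sigma_algebra.
  exists (fun k => if k == i then B else setT).
    by move=> k /=; case: ifP.
  rewrite setTI; apply/seteqP; split => w /=.
    by move=> /(_ i si) /=; rewrite eqxx.
  by move=> Bw k _ /=; case: eqP => // ->.
move=> A B /sub sA /sub sB.
apply: (@independent_pi _ _ _ P (blocks s1) (blocks s2)) => //.
move=> _ _ [B1 mB1 <-] [B2 mB2 <-].
move: (us); rewrite cat_uniq => /and3P[us1 s12 us2].
have B12 i : i \in s2 -> (i \in s1) = false.
  by move=> is2; apply/negbTE/negP => is1; move/hasPn : s12 => /(_ _ is2)/negP.
(* One family of sets serves both blocks, which is consistent because the two lists are disjoint. *)
have := indX (s1 ++ s2) (fun i => if i \in s1 then B1 i else B2 i) us.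
rewrite big_cat/= => indB.
transitivity (P (\bigcap_(i in [set` s1 ++ s2])
    X i @^-1` (if i \in s1 then B1 i else B2 i))).
  congr (P _); apply/seteqP; split => w /=.
    move=> [Bw1 Bw2] i /=; rewrite mem_cat.
    have [is1 _|/= nis1 is2] := boolP (i \in s1); first exact: Bw1.
    exact: Bw2.
  move=> Bw; split => i /= is_.
    by have := Bw i; rewrite /= mem_cat is_/=; exact.
  by have := Bw i; rewrite /= mem_cat is_ B12//= ; exact.
rewrite indB; last by move=> i; case: ifP.
rewrite !indX//; congr (_ * _)%E; rewrite !big_seq; apply: eq_bigr => i is_.
  by rewrite is_.
by rewrite B12.
Qed.

(** Constant coordinates are allowed for the sake of [rest], whose coordinate [l0] is reset to 0. *)
Lemma family_sigma_coord (I L : Type) (D : set I) (X : I -> Omega -> R)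
    (S : Omega -> coord_space R L) :
  (forall l, (exists2 i, D i & (fun w => S w l) = X i) \/
             exists c, forall w, S w l = c) ->
  forall A, measurable A -> family_sigma D X (S @^-1` A).
Proof.
move=> SX A mA.
pose G := \bigcup_(i in D) preimage_set_system setT (X i) measurable.
have mS : measurable_fun setT (S : g_sigma_algebraType G -> coord_space R L).
  apply: measurable_into_coord_space => l.
  have [[i Di SE]|[c Sc]] := SX l; last first.
    rewrite (_ : (fun t => _) = cst c)//; apply/funext => w /=; exact: Sc.
  rewrite [X in measurable_fun _ X]SE => _ B mB.
  by apply: sub_sigma_algebra; exists i => //; exists B.
by have := mS measurableT A mA; rewrite setTI.
Qed.

End families.

(** * Conditional expectation by Fubini *)

Section freezing.
Context {d : measure_display} {Omega : measurableType d} {R : realType}.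
Variable P : probability Omega R.

Local Notation L1 f := (P.-integrable setT (EFin \o f)).
Local Notation E f := (Rintegral P setT f).

Lemma L1_distribution d' (T' : measurableType d') (Z : {mfun Omega >-> T'})
    (f : T' -> R) : measurable_fun setT f ->
  (distribution P Z).-integrable setT (EFin \o f) <-> L1 (f \o Z).
Proof.
move=> mf; have mf' : measurable_fun setT (EFin \o f) by exact/measurable_EFinP.
have mfZ : measurable_fun setT (EFin \o (f \o Z)).
  by apply/measurable_EFinP; exact: measurableT_comp.
have intE : (\int[distribution P Z]_x `|(EFin \o f) x| =
    \int[P]_w `|(EFin \o (f \o Z)) w|)%E.
  rewrite ge0_integral_distribution//; exact: measurableT_comp.
split=> /integrableP[_ fy]; apply/integrableP; split => //.
  by move: fy; rewrite intE.
by move: fy; rewrite -intE.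
Qed.

Lemma E_distribution d' (T' : measurableType d') (Z : {mfun Omega >-> T'})
    (f : T' -> R) : measurable_fun setT f -> L1 (f \o Z) ->
  Rintegral (distribution P Z) setT f = E (f \o Z).
Proof.
move=> mf If; congr fine; rewrite integral_distribution//.
exact/measurable_EFinP.
Qed.

Lemma eq_law_E d' (T' : measurableType d') (Z Z' : {mfun Omega >-> T'})
    (f : T' -> R) :
  (forall A, measurable A -> P (Z @^-1` A) = P (Z' @^-1` A)) ->
  Rintegral (distribution P Z) setT f = Rintegral (distribution P Z') setT f.
Proof.
by move=> ZZ'; congr fine; apply: eq_measure_integral => A mA _; exact: ZZ'.
Qed.

Lemma eq_law_L1 d' (T' : measurableType d') (Z Z' : {mfun Omega >-> T'})
    (f : T' -> R) : measurable_fun setT f ->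
  (forall A, measurable A -> P (Z @^-1` A) = P (Z' @^-1` A)) ->
  L1 (f \o Z) -> L1 (f \o Z').
Proof.
move=> mf ZZ' /(L1_distribution _ mf)/integrableP[mEf fy].
apply/(L1_distribution _ mf)/integrableP; split=> //.
rewrite (eq_measure_integral (distribution P Z))// => A mA _.
by apply/esym; exact: ZZ'.
Qed.

Context {d1 d2 : measure_display} {T1 : measurableType d1} {T2 : measurableType d2}.
Variables (S : {mfun Omega >-> T1}) (U : {mfun Omega >-> T2}).

Definition independent_elements := forall A B, measurable A -> measurable B ->
  (P (S @^-1` A `&` U @^-1` B) = P (S @^-1` A) * P (U @^-1` B))%E.

Hypothesis indSU : independent_elements.

Let mSU : measurable_fun setT (fun w => (S w, U w)).
Proof. by apply: measurable_fun_pair; exact: measurable_funP. Qed.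

Let SU : {mfun Omega >-> (T1 * T2)%type} := mfun_Sub (mem_set mSU).

Local Notation PS := (distribution P S).
Local Notation PU := (distribution P U).

Let law_pair (X : set (T1 * T2)) : measurable X ->
  (PS \x PU)%E X = distribution P SU X.
Proof.
by apply: product_measure_unique => A B mA mB; exact: indSU.
Qed.

Lemma L1_product (f : T1 * T2 -> R) : measurable_fun setT f ->
  L1 (fun w => f (S w, U w)) ->
  (PS \x PU)%E.-integrable setT (EFin \o f).
Proof.
move=> mf /(@L1_distribution _ _ SU f mf)/integrableP[mf' fy].
apply/integrableP; split => //.
rewrite (eq_measure_integral (distribution P SU))// => A mA _.
exact: law_pair.
Qed.

(* By Fubini, freeze f (S) is E[f(S, U) | S] when S and U are independent. *)
Definition freeze (f : T1 * T2 -> R) (s : T1) : R :=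
  Rintegral PU setT (fun u => f (s, u)).

Lemma measurable_freeze (f : T1 * T2 -> R) : measurable_fun setT f ->
  L1 (fun w => f (S w, U w)) -> measurable_fun setT (freeze f).
Proof.
move=> mf If; have := measurable_fubini_F (L1_product mf If).
move=> mF; rewrite (_ : freeze f = fine \o fubini_F PU (EFin \o f))//.
by apply: measurableT_comp => //; exact: measurable_fine.
Qed.

(** The defining property of E[f(S, U) | S], with a test factor a(S) in place of an indicator, since
    orthogonality relations need unbounded factors. *)
Lemma freezeM (a : T1 -> R) (f : T1 * T2 -> R) :
  measurable_fun setT a -> measurable_fun setT f ->
  L1 (fun w => f (S w, U w)) -> L1 (fun w => a (S w) * f (S w, U w)) ->
  L1 (fun w => a (S w) * freeze f (S w)) /\
  E (fun w => a (S w) * f (S w, U w)) = E (fun w => a (S w) * freeze f (S w)).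
Proof.
move=> ma mf If Iaf.
pose F z := a z.1 * f z.
have mF : measurable_fun setT F.
  by apply: measurable_funM => //; exact: measurableT_comp.
have IF := L1_product mF Iaf.
have maG : measurable_fun setT (fun s => a s * freeze f s).
  by apply: measurable_funM => //; exact: measurable_freeze.
have FE : ae_eq PS setT (fubini_F PU (EFin \o F)) (EFin \o (fun s => a s * freeze f s)).
  apply: filterS (ae_integrable1 IF) => s IFs _.
  (* [freeze] takes [fine] of an integral, so f(s, .) must be shown integrable. Where a(s) is
     nonzero, dividing a(s) f(s, .) by it does so for almost every s; where a(s) = 0, both sides
     vanish. *)
  rewrite /fubini_F /=; have [as0|as0] := eqVneq (a s) 0.
    rewrite as0 mul0r; apply: integral0_eq => u _ /=.
    by rewrite /F/= as0 mul0r.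
  have Ifs : PU.-integrable setT (fun u => (f (s, u))%:E).
    apply: eq_integrable (integrableZl measurableT (a s)^-1 IFs) => // u _ /=.
    by rewrite /F/= -EFinM mulrA mulVf// mul1r.
  rewrite /freeze EFinM fineK; last exact: integrable_fin_num.
  by rewrite -integralZl//; apply: eq_integral => u _; rewrite EFinM.
have IFS := integrable_fubini_F IF.
have IaG : PS.-integrable setT (EFin \o (fun s => a s * freeze f s)).
  apply/integrableP; split; first exact/measurable_EFinP.
  move/integrableP : IFS => [mFS]; congr (_ < _)%E.
  apply: ae_eq_integral => //; [exact: measurableT_comp| |].
    by apply: measurableT_comp => //; exact/measurable_EFinP.
  by apply: filterS FE => s FEs _; rewrite FEs.
have IaGS : L1 (fun w => a (S w) * freeze f (S w)).
  by have /(L1_distribution S maG) := IaG.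
split => //.
rewrite -(@E_distribution _ _ S (fun s => a s * freeze f s))//.
rewrite -(@E_distribution _ _ SU F)//.
congr fine; rewrite -(eq_measure_integral _ (fun A mA _ => law_pair mA)).
rewrite -integral12_prod_meas1//; apply: ae_eq_integral => //.
  exact: measurable_int IFS.
exact/measurable_EFinP.
Qed.

End freezing.

(** * Truncation and square integrability *)

Section truncation.
Context {d : measure_display} {T : measurableType d} {R : realType}.

(** Large values are sent to 0 rather than clipped to M, so that the truncation times f is the
    square of the truncation ([truncateM]): truncation and remainder have product 0. *)
Definition truncate (M : R) (f : T -> R) (x : T) : R :=
  if `|f x| <= M then f x else 0.

Lemma measurable_truncate M f : measurable_fun setT f ->
  measurable_fun setT (truncate M f).
Proof.
move=> mf; apply: measurable_fun_ifT => //.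
by apply: measurable_fun_ler => //; exact: measurableT_comp.
Qed.

Lemma truncate_bounded M f x : 0 <= M -> `|truncate M f x| <= M.
Proof. by move=> M0; rewrite /truncate; case: ifPn => // _; rewrite normr0. Qed.

Lemma truncateM M f x : truncate M f x * f x = truncate M f x ^+ 2.
Proof. by rewrite /truncate; case: ifPn; rewrite ?mul0r ?expr0n. Qed.

Variable P : probability T R.
Local Notation L1 f := (P.-integrable setT (EFin \o f)).
Local Notation E f := (Rintegral P setT f).

Lemma sqint_truncate (n : nat) f : measurable_fun setT f ->
  sqint P (truncate n%:R f).
Proof.
move=> mf; apply: (@sqint_bounded _ _ _ _ _ n%:R).
  exact: measurable_truncate.
by move=> x; exact: truncate_bounded.
Qed.

Lemma cvg_integral_truncate f : measurable_fun setT f ->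
  (\int[P]_x (truncate n%:R f x ^+ 2)%:E @[n --> \oo] -->
  \int[P]_x (f x ^+ 2)%:E)%E.
Proof.
move=> mf.
pose u (n : nat) x := (truncate n%:R f x ^+ 2)%:E.
have mu n : measurable_fun setT (u n).
  apply/measurable_EFinP; apply: measurable_funX; exact: measurable_truncate.
have u0 n x : setT x -> (0 <= u n x)%E by rewrite lee_fin sqr_ge0.
have ndu x : setT x -> nondecreasing_seq (u ^~ x).
  move=> _ a b ab; rewrite lee_fin /truncate.
  have [fa|fa] := leP `|f x| a%:R; last by rewrite expr0n sqr_ge0.
  by rewrite (le_trans fa)// ler_nat.
have ucvg x : u n x @[n --> \oo] --> (f x ^+ 2)%:E.
  apply: cvg_near_cst; near=> n.
  rewrite /u /truncate ifT//.
  near: n; exact: nbhs_infty_ger.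
rewrite [X in _ --> X](_ : _ = \int[P]_x limn (u ^~ x))%E.
  exact: cvg_monotone_convergence.
by apply: eq_integral => x _; apply/esym/cvg_lim => //; exact: ucvg.
Unshelve. all: by end_near. Qed.

(** Monotone convergence, as the squared truncations increase to f^2. It yields square integrability
    from bounds that make sense before f is known to be in L^2. *)
Lemma sqint_truncate_limit f C : measurable_fun setT f ->
  (forall n : nat, E (fun x => truncate n%:R f x ^+ 2) <= C) ->
  sqint P f /\ E (fun x => f x ^+ 2) <= C.
Proof.
move=> mf fC.
have fleC : (\int[P]_x (f x ^+ 2)%:E <= C%:E)%E.
  have cvf := cvg_integral_truncate mf.
  rewrite -(cvg_lim _ cvf)//; apply: lime_le; first exact: cvgP cvf.
  apply: nearW => n; rewrite -EFin_E ?lee_fin//.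
  exact: (sqint_truncate n mf).2.
have If : L1 (fun x => f x ^+ 2).
  apply/integrableP; split.
    by apply/measurable_EFinP; exact: measurable_funX.
  under eq_integral do rewrite /= ger0_norm ?sqr_ge0//.
  exact: le_lt_trans fleC (ltry _).
split; first by split.
by rewrite -lee_fin EFin_E.
Qed.

Lemma cvg_truncate f : sqint P f ->
  E (fun x => (f x - truncate n%:R f x) ^+ 2) @[n --> \oo] --> (0 : R).
Proof.
move=> sf; have [mf If] := sf.
have It n := (sqint_truncate n mf).2.
have Ef n : E (fun x => (f x - truncate n%:R f x) ^+ 2) =
    E (fun x => f x ^+ 2) - E (fun x => truncate n%:R f x ^+ 2).
  rewrite -EB//; apply: eq_E => x; have := truncateM n%:R f x; nra.
have cvE : E (fun x => truncate n%:R f x ^+ 2) @[n --> \oo] -->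
    E (fun x => f x ^+ 2).
  by apply: fine_cvg; rewrite EFin_E//; exact: cvg_integral_truncate.
rewrite (funext Ef) -(subrr (E (fun x => f x ^+ 2))).
exact: (cvgB (@cvg_cst _ _ _ _ _) cvE).
Qed.

End truncation.

Section freeze_square.
Context {d : measure_display} {Omega : measurableType d} {R : realType}.
Variable P : probability Omega R.

Local Notation E f := (Rintegral P setT f).
Context {d1 d2 : measure_display} {T1 : measurableType d1} {T2 : measurableType d2}.

(* E[freeze f ^2; |freeze f| <= n] = E[freeze f * f; |freeze f| <= n] bounds the
   truncated second moments by E[f^2], before freeze f is known to be in L^2. *)
Lemma freeze_sqint (S : {mfun Omega >-> T1}) (U : {mfun Omega >-> T2})
    (f : T1 * T2 -> R) :
  independent_elements P S U -> measurable_fun setT f ->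
  sqint P (fun w => f (S w, U w)) ->
  sqint P (fun w => freeze P U f (S w)).
Proof.
move=> indSU mf sf; have If := sqint_L1 sf.
have mG := measurable_freeze indSU mf If.
have mGS : measurable_fun setT (fun w => freeze P U f (S w)).
  exact: measurableT_comp.
apply: (sqint_truncate_limit (C := E (fun w => f (S w, U w) ^+ 2)) mGS _).1 => n.
set a := truncate _ _; have sa : sqint P a by exact: sqint_truncate.
have Iaf := sqintM_L1 sa sf.
have [|_ Eaf] := freezeM (a := truncate n%:R (freeze P U f)) indSU _ mf If Iaf.
  exact: measurable_truncate.
have : E (fun w => a w * f (S w, U w)) <=
    E (fun w => 2^-1 * (a w ^+ 2 + f (S w, U w) ^+ 2)).
  apply: E_le => // [|w].
    by apply: L1Zl; apply: L1D; [exact: sa.2|exact: sf.2].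
  have := sqr_ge0 (a w - f (S w, U w)); rewrite sqrrB; lra.
rewrite EZl ?ED; [|exact: sa.2|exact: sf.2|by apply: L1D; [exact: sa.2|exact: sf.2]].
suff -> : E (fun w => a w * f (S w, U w)) = E (fun w => a w ^+ 2) by lra.
by rewrite [LHS]Eaf; apply: eq_E => w; exact: truncateM.
Qed.

End freeze_square.

Section conditional_expectation.
Context {d : measure_display} {Omega : measurableType d} {R : realType}.
Variable P : probability Omega R.

Local Notation E f := (Rintegral P setT f).

Lemma is_cond_expectation_measurable (X Z : Omega -> R) (S : {RV P >-> R}) :
  is_cond_expectation X S Z -> measurable_fun setT Z.
Proof.
move=> [_ mZ _] _ B mB; rewrite setTI.
have [C mC <-] := mZ B mB; rewrite setTI.
exact: measurable_RV_preimage.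
Qed.

(** The event Z' < Z belongs to sigma(S), so Z and Z' have the same integral over it; the positive
    function Z - Z' thus integrates to 0 there, and the event is null. *)
Lemma cond_expectation_ae_le (X Z Z' : Omega -> R) (S : {RV P >-> R}) :
  is_cond_expectation X S Z -> is_cond_expectation X S Z' ->
  {ae P, forall w, Z w <= Z' w}.
Proof.
move=> cZ cZ'.
have mZ := is_cond_expectation_measurable cZ.
have mZ' := is_cond_expectation_measurable cZ'.
have [iZ sZ intZ] := cZ; have [iZ' sZ' intZ'] := cZ'.
pose A := [set w | Z' w < Z w].
have SA : g_sigma_algebra_preimage S A.
  have mS (V : Omega -> R) :
      (forall B, measurable B -> g_sigma_algebra_preimage S (V @^-1` B)) ->
      measurable_fun setT (V : g_sigma_algebra_preimageType S -> R).
    by move=> sV _ B mB; rewrite setTI; exact: sV.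
  have mltr := measurable_fun_ltr (mS _ sZ') (mS _ sZ).
  have := mltr measurableT [set true] I.
  by rewrite setTI; congr g_sigma_algebra_preimage; apply/seteqP; split.
have mA : measurable A.
  by case: SA => C mC <-; rewrite setTI; exact: measurable_RV_preimage.
have iZA : P.-integrable A (EFin \o Z) by exact: integrableS iZ.
have iZA' : P.-integrable A (EFin \o Z') by exact: integrableS iZ'.
have int0 : (\int[P]_(w in A) `|(Z w - Z' w)%:E| = 0)%E.
  transitivity (\int[P]_(w in A) (Z w - Z' w)%:E)%E.
    apply: eq_integral => w /set_mem Aw /=.
    by rewrite ger0_norm// subr_ge0 ltW.
  rewrite integralB_EFin// intZ// -intZ'// subee//.
  exact: integrable_fin_num.
have mD : measurable_fun A (EFin \o (fun w => Z w - Z' w)).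
  apply/measurable_EFinP; apply: measurable_funTS; exact: measurable_funB.
have /(ae_eq_integral_abs P mA mD) := int0.
apply: filterS => w Aw; rewrite leNgt; apply/negP => ZZ'.
by have /eqP := Aw ZZ'; rewrite eqe subr_eq0 gt_eqF.
Qed.

(** This frees [v10] and [v01] from the version chosen by [xget]: an explicit version such as
    g(xi_1) may be used instead. *)
Lemma fine_variance_cond_expectation (X Z : Omega -> R) (S : {RV P >-> R}) :
  P.-integrable setT (EFin \o X) -> is_cond_expectation X S Z ->
  fine 'V_P[cond_expectation X S] = E (fun w => (Z w - E Z) ^+ 2).
Proof.
move=> iX cZ; set Z' := cond_expectation X S.
have cZ' : is_cond_expectation X S Z' by exact: is_cond_expectationP.
have ZZ' : {ae P, forall w, Z' w = Z w}.
  have := cond_expectation_ae_le cZ cZ'; have := cond_expectation_ae_le cZ' cZ.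
  by apply: filterS2 => w h1 h2; apply/eqP; rewrite eq_le h1 h2.
have mZ := is_cond_expectation_measurable cZ.
have mZ' := is_cond_expectation_measurable cZ'.
rewrite /variance unlock unlock -/(Rintegral P setT Z') (E_ae mZ' mZ ZZ').
apply: E_ae => [||].
- by apply: measurable_funM; exact: measurable_funB.
- by apply: measurable_funX; exact: measurable_funB.
- by apply: filterS ZZ' => w; rewrite expr2 => /= <-.
Qed.

End conditional_expectation.

(** * Kernels of blocks of AHK variables *)

Section kernels.
Context {R : realType} (p q : nat).

Lemma measurable_kernel_function (h : 'M[R]_(p, q) -> R) d (T : measurableType d)
    (M : T -> 'M[R]_(p, q)) : kernel_function h ->
  (forall a b, measurable_fun setT (fun t => M t a b)) ->
  measurable_fun setT (fun t => h (M t)).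
Proof.
move=> hh mM _ B mB; rewrite setTI.
pose G := \bigcup_(ab in setT) preimage_set_system setT
  (fun M : 'M[R]_(p, q) => M ab.1 ab.2) measurable.
have mM' : measurable_fun setT (M : T -> g_sigma_algebraType G).
  refine (@measurability _ _ T (g_sigma_algebraType G) setT M G erefl _).
  move=> _ [_ [[a b] _ [C mC <-]] <-]; rewrite !setTI /=.
  by have := mM a b measurableT C mC; rewrite setTI.
have hB : measurable (h @^-1` B : set (g_sigma_algebraType G)).
  exact: (kernel_measurable hh mB).
by have := mM' measurableT _ hB; rewrite setTI.
Qed.

End kernels.

Section blocks.
Context {d : measure_display} {Omega : measurableType d} {R : realType}.
Variable P : probability Omega R.
Variables (xi eta : nat -> {RV P >-> R}) (zeta : nat -> nat -> {RV P >-> R}).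
Local Notation X := (AHK_variables xi eta zeta).
Hypothesis indX : mutually_independent X.
Hypothesis lawX : forall k l (B : set R), measurable B ->
  P (X k @^-1` B) = P (X l @^-1` B).
Variables (p q : nat) (h : 'M[R]_(p, q) -> R).
Hypothesis p_gt0 : (0 < p)%N.
Hypothesis h_kernel : kernel_function h.
Variable psi : R * R * R -> R.
Hypothesis mpsi : measurable_fun setT psi.

Local Notation E f := (Rintegral P setT f).

Definition block_index : finType := (('I_p + 'I_q) + 'I_p * 'I_q)%type.

Definition embed (r : 'I_p -> nat) (c : 'I_q -> nat) (l : block_index) :
    (nat + nat) + nat * nat :=
  match l with
  | inl (inl a) => inl (inl (r a))
  | inl (inr b) => inl (inr (c b))
  | inr (a, b) => inr (r a, c b)
  end.

Lemma embed_inj r c : injective r -> injective c -> injective (embed r c).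
Proof.
by move=> ri ci [[a|b]|[a b]] [[a'|b']|[a' b']] //= [] => [/ri->|/ci->|/ri-> /ci->].
Qed.

Local Notation space := (coord_space R block_index).

Definition kernel_of_block (u : space) : R :=
  h (\matrix_(a < p, b < q) psi (u (inl (inl a)), u (inl (inr b)), u (inr (a, b)))).

Lemma measurable_kernel_of_block : measurable_fun setT kernel_of_block.
Proof.
apply: measurable_kernel_function => // a b.
rewrite (_ : (fun t => _) = psi \o
    (fun u : space => (u (inl (inl a)), u (inl (inr b)), u (inr (a, b)))));
  last by apply/funext => u /=; rewrite mxE.
apply: (measurableT_comp mpsi).
by do 2?[apply: measurable_fun_pair]; exact: measurable_coord.
Qed.

Definition block r c (w : Omega) : space := fun l => X (embed r c l) w.

Definition kernel_at r c (w : Omega) : R :=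
  h (\matrix_(a < p, b < q)
       psi (xi (r a) w, eta (c b) w, zeta (r a) (c b) w)).

Lemma kernel_atE r c w : kernel_at r c w = kernel_of_block (block r c w).
Proof. by []. Qed.

Lemma measurable_block r c : measurable_fun setT (block r c).
Proof. by apply: measurable_into_coord_space => l; exact: measurable_funP. Qed.

Let block_mfun r c : {mfun Omega >-> space} :=
  mfun_Sub (mem_set (measurable_block r c)).

Let row0 : 'I_p := Ordinal p_gt0.
Let l0 : block_index := inl (inl row0).

(* The block seen as a function of xi_1 (coordinate l0) and of the other variables;
   resetting l0 to 0 makes these others independent of xi_1 on a single space. *)
Definition set_row0 (x : R) (u : space) : space :=
  fun l => if l == l0 then x else u l.

Lemma measurable_set_row0 d' (T : measurableType d') (x : T -> R) (u : T -> space) :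
  measurable_fun setT x -> measurable_fun setT u ->
  measurable_fun setT (fun t => set_row0 (x t) (u t)).
Proof.
move=> mx mu; apply: measurable_into_coord_space => l; rewrite /set_row0.
by case: eqP => // _; apply: (measurableT_comp (measurable_coord l)).
Qed.

Let measurable_rest r c : measurable_fun setT (fun w => set_row0 0 (block r c w)).
Proof. by apply: measurable_set_row0 => //; exact: measurable_block. Qed.

Let rest r c : {mfun Omega >-> space} := mfun_Sub (mem_set (measurable_rest r c)).

Let F (xu : R * space) : R := kernel_of_block (set_row0 xu.1 xu.2).

Let mF : measurable_fun setT F.
Proof.
apply: (measurableT_comp measurable_kernel_of_block).
by apply: measurable_set_row0; [exact: measurable_fst|exact: measurable_snd].
Qed.

Let F_rest r c w : F (xi (r row0) w, rest r c w) = kernel_at r c w.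
Proof.
rewrite kernel_atE /F /=; congr kernel_of_block; apply/funext => l.
by rewrite /set_row0; case: eqP => // ->.
Qed.

(** Injective r and c select distinct AHK variables, and these are i.i.d. *)
Lemma block_law r c r' c' : injective r -> injective c ->
  injective r' -> injective c' -> forall A : set space, measurable A ->
  P (block r c @^-1` A) = P (block r' c' @^-1` A).
Proof.
move=> ri ci ri' ci'.
apply: (same_law (mutually_independent_comp (embed_inj ri ci) indX)
  (mutually_independent_comp (embed_inj ri' ci') indX)).
by move=> l B mB; exact: lawX.
Qed.

(** The list s1 holds the variables on which S depends. It may contain the variable at [l0], which
    [rest] does not see. *)
Lemma independent_rest r c (s1 : seq ((nat + nat) + nat * nat)) d1
    (T1 : measurableType d1) (S : {mfun Omega >-> T1}) :
  injective r -> injective c -> uniq s1 ->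
  (forall l, l != l0 -> embed r c l \notin s1) ->
  (forall A, measurable A -> family_sigma [set` s1] X (S @^-1` A)) ->
  independent_elements P S (rest r c).
Proof.
move=> ri ci us1 s1r SX A B mA mB.
pose s2 := [seq embed r c l | l <- enum block_index & l != l0].
apply: (@independent_blocks _ _ _ P _ X s1 s2) => //; last 1 first.
- apply: family_sigma_coord => // l /=; rewrite /set_row0.
  have [_|ll0] := eqVneq l l0; first by right; exists 0.
  left; exists (embed r c l) => //=.
  by rewrite map_f// mem_filter ll0 mem_enum.
- have us2 : uniq s2.
    rewrite map_inj_uniq; last exact: embed_inj.
    by rewrite filter_uniq// enum_uniq.
  rewrite cat_uniq us1 us2 andbT /=.
  apply/hasPn => x /mapP[l + ->]; rewrite mem_filter => /andP[ll0 _].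
  exact: s1r.
- exact: SX.
Qed.

Let independent_xi_rest r c : injective r -> injective c ->
  independent_elements P (xi (r row0)) (rest r c).
Proof.
move=> ri ci; apply: (@independent_rest r c [:: embed r c l0]) => //.
  by move=> l ll0; rewrite inE (inj_eq (embed_inj ri ci)).
move=> A mA; apply: sub_sigma_algebra; exists (embed r c l0); first exact: mem_head.
by exists A => //; rewrite setTI.
Qed.

Hypothesis kernel_sqint : sqint P (kernel_at val val).

Lemma sqint_kernel_at r c : injective r -> injective c ->
  sqint P (kernel_at r c) /\
  E (fun w => kernel_at r c w ^+ 2) = E (fun w => kernel_at val val w ^+ 2).
Proof.
move=> ri ci.
have mk2 : measurable_fun setT (fun u => kernel_of_block u ^+ 2).
  by apply: measurable_funX; exact: measurable_kernel_of_block.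
have law := block_law val_inj val_inj ri ci.
have I2 := @eq_law_L1 _ _ _ P _ _ (block_mfun val val) (block_mfun r c) _ mk2 law
  kernel_sqint.2.
split; first split => //.
  exact: (measurableT_comp measurable_kernel_of_block (measurable_block r c)).
have := @eq_law_E _ _ _ P _ _ (block_mfun val val) (block_mfun r c)
  (fun u => kernel_of_block u ^+ 2) law.
by rewrite !E_distribution//; exact: kernel_sqint.2.
Qed.

(** The function g with g(xi_i) = E[h | xi_i]. It is computed from the leading block, but by
    [freeze_rest] every block gives the same function, because all the [rest r c] have one law. *)
Definition row_projection : R -> R := freeze P (rest val val) F.

Lemma freeze_rest r c : injective r -> injective c ->
  freeze P (rest r c) F = row_projection.
Proof.
move=> ri ci; apply/funext => x; apply: eq_law_E => A mA.
apply: (block_law ri ci val_inj val_inj (A := set_row0 0 @^-1` A)).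
rewrite -[X in measurable X]setTI.
by apply: (@measurable_set_row0 _ space (fun _ => 0) id).
Qed.

Let sqint_F_rest r c : injective r -> injective c ->
  sqint P (fun w => F (xi (r row0) w, rest r c w)).
Proof.
move=> ri ci; apply: eq_sqint (sqint_kernel_at ri ci).1 => w.
by rewrite F_rest.
Qed.

Lemma measurable_row_projection : measurable_fun setT row_projection.
Proof.
apply: (@measurable_freeze _ _ _ P _ _ _ _ (xi 0%N) (rest val val)) => //.
  exact: (independent_xi_rest val_inj val_inj).
exact: sqint_L1 (sqint_F_rest val_inj val_inj).
Qed.

Lemma sqint_row_projection i : sqint P (fun w => row_projection (xi i w)).
Proof.
(* Rows i, ..., i+p-1: any injective choice sending [row0] to i would do. *)
pose r (a : 'I_p) := (i + a)%N.
have ri : injective r by move=> a b /addnI/val_inj.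
have <- : r row0 = i by rewrite /r /= addn0.
rewrite -(freeze_rest ri (@val_inj _ _ 'I_q)).
apply: freeze_sqint => //; first exact: independent_xi_rest.
exact: sqint_F_rest.
Qed.

Lemma E_kernel_mul_row r c (a : R -> R) : injective r -> injective c ->
  measurable_fun setT a -> sqint P (fun w => a (xi (r row0) w)) ->
  E (fun w => a (xi (r row0) w) * kernel_at r c w) =
  E (fun w => a (xi (r row0) w) * row_projection (xi (r row0) w)).
Proof.
move=> ri ci ma sa; rewrite -(freeze_rest ri ci).
have sF := sqint_F_rest ri ci.
rewrite -(freezeM (independent_xi_rest ri ci) ma mF (sqint_L1 sF) (sqintM_L1 sa sF)).2.
by apply: eq_E => w; rewrite F_rest.
Qed.

(** Conditional independence given the shared row variable. The second kernel is frozen over the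
    whole first block, of which it sees only that variable. *)
Lemma E_kernel_mul_kernel r c r' c' :
  injective r -> injective c -> injective r' -> injective c' ->
  r' row0 = r row0 -> (forall a a', r a = r' a' -> a' = row0) ->
  (forall b b', c b <> c' b') ->
  E (fun w => kernel_at r c w * kernel_at r' c' w) =
  E (fun w => kernel_at r c w * row_projection (xi (r row0) w)).
Proof.
move=> ri ci ri' ci' rr' rdisj cdisj.
have ind : independent_elements P (block_mfun r c) (rest r' c').
  apply: (@independent_rest r' c' [seq embed r c l | l <- enum block_index]) => //.
  - by rewrite map_inj_uniq ?enum_uniq//; exact: embed_inj.
  (* Distinct columns force distinct cell variables, even on the shared row; only the row variable
     at [l0] can be common. *)
  - move=> l; apply: contra => /mapP[l' _].
    case: l l' => [[a|b]|[a b]] [[a'|b']|[a' b']] //= [].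
    + by move=> /esym/rdisj ->.
    + by move=> /esym/cdisj.
    + by move=> _ /esym/cdisj.
  - move=> A mA; apply: family_sigma_coord => // l; left.
    by exists (embed r c l) => //=; rewrite map_f// mem_enum.
pose F' (su : space * space) := F (su.1 l0, su.2).
have mF' : measurable_fun setT F'.
  apply: (measurableT_comp mF); apply: measurable_fun_pair => //.
  apply: (measurableT_comp (measurable_coord l0)); exact: measurable_fst.
have F'E w : F' (block_mfun r c w, rest r' c' w) = kernel_at r' c' w.
  by rewrite /F' /= /block /= -rr' F_rest.
have sF' : sqint P (fun w => F' (block_mfun r c w, rest r' c' w)).
  by apply: eq_sqint (sqint_kernel_at ri' ci').1 => w; rewrite F'E.
have sa := (sqint_kernel_at ri ci).1.
have := (freezeM ind measurable_kernel_of_block mF' (sqint_L1 sF') (sqintM_L1 sa sF')).2.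
rewrite [LHS](_ : _ = E (fun w => kernel_at r c w * kernel_at r' c' w)); last first.
  by apply: eq_E => w; rewrite F'E.
move=> ->; apply: eq_E => w.
by rewrite -(freeze_rest ri' ci').
Qed.

Lemma row_projection_cond_expectation :
  is_cond_expectation (kernel_at val val) (xi 0%N)
    (fun w => row_projection (xi 0%N w)).
Proof.
have sg := sqint_row_projection 0.
have sk := kernel_sqint.
split; first exact: (sqint_L1 sg).
  move=> B mB; exists (row_projection @^-1` B); last by rewrite setTI.
  rewrite -[X in measurable X]setTI; exact: measurable_row_projection.
move=> _ [B mB <-]; rewrite setTI.
have mA : measurable (xi 0%N @^-1` B) by exact: measurable_RV_preimage.
(* The indicator of B serves as test factor, which turns integrals over events of sigma(xi_1) into
   expectations of products. *)
have mB1 : measurable_fun setT (\1_B : R -> R) by exact: measurable_indic.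
have s1 : sqint P (fun w => \1_B (xi 0%N w) : R).
  apply: (@sqint_bounded _ _ _ _ _ 1); first exact: measurableT_comp.
  by move=> w; rewrite indicE; case: (_ \in _); rewrite ?normr1 ?normr0.
have intE (f : Omega -> R) : sqint P f ->
    (\int[P]_(w in xi 0%N @^-1` B) (f w)%:E)%E = (E (fun w => \1_B (xi 0%N w) * f w))%:E.
  move=> sf; rewrite EFin_E; last exact: sqintM_L1.
  rewrite integral_mkcond; apply: eq_integral => w _.
  rewrite patchE indicE /=; case: ifPn => wB.
    by rewrite mem_set ?mul1r//; exact: set_mem wB.
  by rewrite memNset ?mul0r// => Bw; rewrite mem_set in wB.
rewrite (intE _ sg) (intE _ sk).
by congr EFin; rewrite -(E_kernel_mul_row val_inj val_inj mB1 s1).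
Qed.

End blocks.

(** * Mean square error of mu_hat *)

Section mu_hat_estimate.
Context {d : measure_display} {Omega : measurableType d} {R : realType}.
Variable P : probability Omega R.
Variables (xi eta : nat -> {RV P >-> R}) (zeta : nat -> nat -> {RV P >-> R}).
Local Notation X := (AHK_variables xi eta zeta).
Hypothesis indX : mutually_independent X.
Hypothesis lawX : forall k l (B : set R), measurable B ->
  P (X k @^-1` B) = P (X l @^-1` B).
Variables (p q : nat) (h : 'M[R]_(p, q) -> R).
Hypotheses (p_gt0 : (0 < p)%N) (q_gt0 : (0 < q)%N).
Hypothesis h_kernel : kernel_function h.
Variable psi : R * R * R -> R.
Hypothesis mpsi : measurable_fun setT psi.
Local Notation W := (kernel_at xi eta zeta h psi).
Hypothesis kernel_sqint : sqint P (W val val).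

Local Notation E f := (Rintegral P setT f).
Local Notation y w := (fun i j => psi (xi i w, eta j w, zeta i j w)).
Local Notation g := (row_projection xi eta zeta h p_gt0 psi).
Local Notation row0 := (Ordinal p_gt0).

Lemma nth_enum_inj m k (I : {set 'I_m}) : #|I| = k ->
  injective (fun a : 'I_k => nth 0%N [seq val i | i <- enum I] a) /\
  (forall a : 'I_k, exists2 i, i \in I &
    nth 0%N [seq val i | i <- enum I] a = val i).
Proof.
move=> cI; have szI : size [seq val i | i <- enum I] = k by rewrite size_map -cardE.
split=> [a b /eqP|a].
  rewrite nth_uniq ?szI ?ltn_ord//; first by move=> /eqP/val_inj.
  by rewrite (map_inj_uniq val_inj) enum_uniq.
have : nth 0%N [seq val i | i <- enum I] a \in [seq val i | i <- enum I].
  by rewrite mem_nth// szI.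
by move=> /mapP[i]; rewrite mem_enum => iI ->; exists i.
Qed.

(** [submatrix] lists rows in increasing order, so i may stand anywhere. Invariance of h under the
    transposition s moves it to [row0], where the projection is taken. *)
Lemma kernel_at_submatrix m n (i : 'I_m) (I : {set 'I_m}) (J : {set 'I_n}) :
  #|I| = p -> i \in I -> #|J| = q ->
  exists (r : 'I_p -> nat) (c : 'I_q -> nat), [/\ injective r, injective c, r row0 = i,
    (forall a, exists2 k, k \in I & r a = val k) /\
    (forall b, exists2 k, k \in J & c b = val k)
    & forall w, h (submatrix p q (y w) I J) = W r c w].
Proof.
move=> cI iI cJ.
have [rI rIP] := nth_enum_inj cI; have [cJI cJP] := nth_enum_inj cJ.
pose l := [seq val k | k <- enum I].
have szl : size l = p by rewrite size_map -cardE.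
have il : val i \in l by rewrite map_f// mem_enum.
have ip : (index (val i) l < p)%N by rewrite -[X in (_ < X)%N]szl index_mem.
pose s := tperm row0 (Ordinal ip).
exists (fun a => nth 0%N l (s a)), (fun b => nth 0%N [seq val k | k <- enum J] b).
split => //.
- by move=> a b /rI/perm_inj.
- by rewrite /s tpermL nth_index.
- move=> w; rewrite -(kernel_invariant h_kernel s 1%g) /kernel_at.
  by congr h; apply/matrixP => a b; rewrite !mxE perm1.
Qed.

Let D m n (i : 'I_m) (A : {set 'I_m} * {set 'I_n}) w :=
  h (submatrix p q (y w) A.1 A.2) - g (xi i w).

Let M2 := E (fun w => W val val w ^+ 2).

Let E_kernel_row r c : injective r -> injective c ->
  E (fun w => W r c w * g (xi (r row0) w)) = E (fun w => g (xi (r row0) w) ^+ 2).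
Proof.
move=> ri ci; rewrite [RHS](_ : _ = E (fun w => g (xi (r row0) w) * g (xi (r row0) w))).
  rewrite -(E_kernel_mul_row indX lawX h_kernel mpsi kernel_sqint ri ci).
  - by apply: eq_E => w; rewrite mulrC.
  - exact: measurable_row_projection.
  - exact: sqint_row_projection.
by apply: eq_E => w; rewrite expr2.
Qed.

(** Pythagoras: g(xi_i) is an orthogonal projection of the kernel, so E D^2 is [M2] minus E
    g(xi_i)^2. *)
Let D_sqint m n (i : 'I_m) (A : {set 'I_m} * {set 'I_n}) : index_pair p q i A ->
  sqint P (D i A) /\ E (fun w => D i A w ^+ 2) <= M2.
Proof.
case/andP => /andP[/eqP cI iI] /eqP cJ.
have [r [c [ri ci ri0 _ WE]]] := kernel_at_submatrix cI iI cJ.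
have [sW EW] := sqint_kernel_at indX lawX h_kernel mpsi kernel_sqint ri ci.
have sg : sqint P (fun w => g (xi (r row0) w)) by exact: sqint_row_projection.
have DE w : D i A w = W r c w - g (xi (r row0) w) by rewrite /D WE ri0.
have sD : sqint P (D i A).
  by apply: eq_sqint (sqintB sW sg) => w; rewrite DE.
split => //.
have E2 : E (fun w => D i A w ^+ 2) = M2 - E (fun w => g (xi (r row0) w) ^+ 2).
  have Wg := sqintM_L1 sW sg.
  transitivity (E (fun w => W r c w ^+ 2 - 2 * (W r c w * g (xi (r row0) w)) +
      g (xi (r row0) w) ^+ 2)).
    by apply: eq_E => w; rewrite DE; ring.
  rewrite ED ?EB ?EZl ?E_kernel_row ?EW//; [|exact: sW.2|exact: L1Zl|..].
  - by rewrite -/M2; ring.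
  - by apply: L1B; [exact: sW.2|exact: L1Zl].
  - exact: sg.2.
by rewrite E2 lerBlDr lerDl E_ge0// => w; exact: sqr_ge0.
Qed.

(** Expanding the product of the two differences gives four expectations, all equal to E g(xi_i)^2,
    with signs that cancel. *)
Let D_orthogonal m n (i : 'I_m) (A B : {set 'I_m} * {set 'I_n}) :
  index_pair p q i A -> index_pair p q i B -> ~~ overlap i A B ->
  E (fun w => D i A w * D i B w) = 0.
Proof.
case/andP => /andP[/eqP cI iI] /eqP cJ /andP[/andP[/eqP cI' iI'] /eqP cJ'].
rewrite negb_or => /andP[/existsPn disI /existsPn disJ].
have [r [c [ri ci ri0 [rI cI_] WE]]] := kernel_at_submatrix cI iI cJ.
have [r' [c' [ri' ci' ri0' [rI' cI'_] WE']]] := kernel_at_submatrix cI' iI' cJ'.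
have [sW _] := sqint_kernel_at indX lawX h_kernel mpsi kernel_sqint ri ci.
have [sW' _] := sqint_kernel_at indX lawX h_kernel mpsi kernel_sqint ri' ci'.
have sg : sqint P (fun w => g (xi i w)) by exact: sqint_row_projection.
have EWg : E (fun w => W r c w * g (xi i w)) = E (fun w => g (xi i w) ^+ 2).
  by rewrite -ri0 E_kernel_row.
have EWg' : E (fun w => W r' c' w * g (xi i w)) = E (fun w => g (xi i w) ^+ 2).
  by rewrite -ri0' E_kernel_row.
have EWW' : E (fun w => W r c w * W r' c' w) = E (fun w => g (xi i w) ^+ 2).
  rewrite (E_kernel_mul_kernel indX lawX (p_gt0 := p_gt0)) ?ri0 ?ri0'//.
    move=> a a' raa'; apply: ri'; rewrite ri0'.
    have [k kI rk] := rI a; have [k' kI' rk'] := rI' a'.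
    move: raa'; rewrite rk rk' => /val_inj kk'; rewrite kk' in kI.
    by have := disI k'; rewrite kI kI' !andbT negbK => /eqP <-.
  move=> b b' cbb'; have [k kJ ck] := cI_ b; have [k' kJ' ck'] := cI'_ b'.
  move: cbb'; rewrite ck ck' => /val_inj kk'; rewrite kk' in kJ.
  by have := disJ k'; rewrite kJ kJ'.
transitivity (E (fun w => (W r c w * W r' c' w - W r c w * g (xi i w)) -
    (W r' c' w * g (xi i w) - g (xi i w) ^+ 2))).
  by apply: eq_E => w; rewrite /D WE WE'; ring.
rewrite EB; last 2 first.
- by apply: L1B; exact: sqintM_L1.
- by apply: L1B; [exact: sqintM_L1|exact: sg.2].
rewrite !EB ?EWW' ?EWg ?EWg' ?subrr//; try exact: sqintM_L1.
Qed.

(** In the expanded square, pairs without overlap contribute 0 and the others at most [M2] each;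
    [overlap_bound] weighs the latter. *)
Lemma mu_hat_mean_square m n (i : 'I_m) :
  (p <= m)%N -> (q <= n)%N -> (1 < m)%N ->
  sqint P (fun w => mu_hat h (y w) n i - g (xi i w)) /\
  E (fun w => (mu_hat h (y w) n i - g (xi i w)) ^+ 2) <=
    M2 * (p.-1%:R ^+ 2 / m.-1%:R + q%:R ^+ 2 / n%:R).
Proof.
move=> pm qn m1.
pose wt : R := pair_weight R m n p q.
(* The weights sum to 1, so centring the average centres each term. *)
have muE w : mu_hat h (y w) n i - g (xi i w) =
    wt * \sum_(A | index_pair p q i A) D (n := n) i A w.
  rewrite sumrB mulrBr; congr (_ - _); last first.
    rewrite -[LHS]mul1r -(sum1_index_pair R i p_gt0 q_gt0 pm qn m1) -/wt.
    by rewrite -mulrA mulr_suml; congr (_ * _); apply: eq_bigr => A _; rewrite mul1r.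
  rewrite /mu_hat /wt /pair_weight; congr (_ * _).
  by rewrite pair_big.
have sD A : index_pair p q i A -> sqint P (D (n := n) i A).
  by move=> /D_sqint[].
have sS := sqint_sum (index_enum _) sD.
split; first by apply: eq_sqint (sqintZl wt sS) => w; rewrite muE.
rewrite (_ : E _ = wt ^+ 2 * E (fun w => (\sum_(A | index_pair p q i A) D (n := n) i A w) ^+ 2)).
  have M20 : 0 <= M2 by apply: E_ge0 => w; exact: sqr_ge0.
  rewrite E_sqr_sum//; apply: le_trans (ler_wpM2l M20
    (overlap_bound R i p_gt0 q_gt0 pm qn m1)).
  rewrite mulrCA; apply: ler_wpM2l; first exact: sqr_ge0.
  rewrite mulr_sumr; apply: ler_sum => A iA; rewrite mulr_sumr; apply: ler_sum => B iB.
  have [ov|nov] := boolP (overlap i A B); last by rewrite mulr0 D_orthogonal.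
  by rewrite mulr1 E_mul_bound//; [exact: sD|exact: sD|
    exact: (D_sqint iA).2|exact: (D_sqint iB).2].
rewrite -EZl; last exact: sS.2.
by apply: eq_E => w; rewrite muE exprMn.
Qed.

End mu_hat_estimate.

(** * Empirical variance *)

Section empirical_variance.
Context {R : realType}.
Implicit Types (a b t : R) (m : nat).

(** [v10_hat] is by conversion the [emp_var] of the [mu_hat]. *)
Definition emp_var m (x : 'I_m -> R) : R :=
  'C(m, 2)%:R^-1 * \sum_(i < m) \sum_(j < m | (i < j)%N) (x i - x j) ^+ 2 / 2.

(** With c = b - a, the difference is 2ac + c^2, and expanding (ta - c)^2 and (ta + c)^2 bounds
    |2ac| by t a^2 + c^2 / t. *)
Lemma sqr_perturb t a b : 0 < t ->
  `|b ^+ 2 - a ^+ 2| <= t * a ^+ 2 + (1 + t^-1) * (b - a) ^+ 2.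
Proof.
move=> t0; set c := b - a; have -> : b = a + c by rewrite /c; ring.
have h1 : 0 <= t^-1 * (t * a - c) ^+ 2 by rewrite mulr_ge0// ?invr_ge0 ?sqr_ge0// ltW.
have h2 : 0 <= t^-1 * (t * a + c) ^+ 2 by rewrite mulr_ge0// ?invr_ge0 ?sqr_ge0// ltW.
have e1 : t^-1 * (t * a - c) ^+ 2 = t * a ^+ 2 + t^-1 * c ^+ 2 - 2 * a * c.
  by field; rewrite gt_eqF.
have e2 : t^-1 * (t * a + c) ^+ 2 = t * a ^+ 2 + t^-1 * c ^+ 2 + 2 * a * c.
  by field; rewrite gt_eqF.
rewrite e1 in h1; rewrite e2 in h2; have := sqr_ge0 c.
rewrite ler_norml => c0; apply/andP; split; nra.
Qed.

Lemma emp_var_perturb t m (x z : 'I_m -> R) : 0 < t ->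
  `|emp_var z - emp_var x| <=
    t * emp_var x + (1 + t^-1) * emp_var (fun i => z i - x i).
Proof.
move=> t0; rewrite /emp_var -mulrBr normrM ger0_norm ?invr_ge0//.
rewrite !(mulrCA _ 'C(m, 2)%:R^-1) -mulrDr ler_wpM2l ?invr_ge0//.
rewrite !mulr_sumr -sumrB -big_split/=; apply: le_trans (ler_norm_sum _ _ _) _.
apply: ler_sum => i _; rewrite !mulr_sumr -sumrB -big_split/=.
apply: le_trans (ler_norm_sum _ _ _) _; apply: ler_sum => j _.
rewrite -mulrBl normrM (ger0_norm (x := 2^-1))// !mulrA -mulrDl ler_wpM2r//.
have -> : z i - x i - (z j - x j) = (z i - z j) - (x i - x j) by ring.
by rewrite -!mulrA; exact: sqr_perturb.
Qed.

Lemma emp_var_shift m (x : 'I_m -> R) a : emp_var (fun i => x i - a) = emp_var x.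
Proof.
congr (_ * _); apply: eq_bigr => i _; apply: eq_bigr => j _.
by congr (_ ^+ 2 / 2); ring.
Qed.

Lemma emp_varE m (x : 'I_m -> R) : (1 < m)%N ->
  emp_var x = m.-1%:R^-1 * (\sum_i x i ^+ 2 - m%:R^-1 * (\sum_i x i) ^+ 2).
Proof.
move=> m1; set S2 := \sum_i x i ^+ 2; set S1 := \sum_i x i.
set U := \sum_(i < m) \sum_(j < m | (i < j)%N) (x i - x j) ^+ 2.
have UU : U = \sum_(i < m) \sum_(j < m | (j < i)%N) (x i - x j) ^+ 2.
  rewrite /U (exchange_big_dep predT)//=; apply: eq_bigr => i _; apply: eq_bigr => j _.
  by rewrite -sqrrN opprB.
(* Doubling replaces the sum over i < j by a full square sum, whose diagonal is zero. *)
have U2 : U + U = \sum_(i < m) \sum_(j < m) (x i - x j) ^+ 2.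
  rewrite {2}UU -big_split/=; apply: eq_bigr => i _.
  rewrite big_mkcond [X in _ + X]big_mkcond -big_split/=; apply: eq_bigr => j _.
  case: ltngtP => [_|_|/ord_inj ->]; rewrite ?addr0 ?add0r//.
  by rewrite subrr expr0n.
have UE : U + U = 2 * (m%:R * S2 - S1 ^+ 2).
  rewrite U2 (eq_bigr (fun i => m%:R * x i ^+ 2 + S2 - 2 * x i * S1)); last first.
    move=> i _; rewrite (eq_bigr (fun j => x i ^+ 2 + x j ^+ 2 - 2 * x i * x j)).
      rewrite sumrB big_split/= sumr_const card_ord -mulr_sumr -/S1 -/S2.
      by rewrite -[_ *+ m]mulr_natl.
    by move=> j _; ring.
  rewrite sumrB big_split/= sumr_const card_ord -!mulr_sumr -mulr_suml -mulr_sumr.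
  by rewrite -/S1 -/S2 -mulr_natl; ring.
have UE' : U = m%:R * S2 - S1 ^+ 2 by lra.
rewrite /emp_var (_ : \sum_(i < m) _ = U / 2); last first.
  by rewrite /U mulr_suml; apply: eq_bigr => i _; rewrite mulr_suml.
have bin2E : 'C(m, 2)%:R = m%:R * m.-1%:R / 2 :> R.
  have := congr1 (fun k => k%:R : R) (mul_bin_diag m 1).
  by rewrite bin1 !natrM => ->; field.
have m0 : m%:R != 0 :> R by rewrite pnatr_eq0; lia.
have m10 : m.-1%:R != 0 :> R by rewrite pnatr_eq0; lia.
by rewrite UE' bin2E; field; rewrite m0 m10.
Qed.

Lemma emp_var_le m (x : 'I_m -> R) : (1 < m)%N ->
  emp_var x <= m.-1%:R^-1 * \sum_i x i ^+ 2.
Proof.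
move=> m1; rewrite emp_varE// ler_wpM2l ?invr_ge0// gerBl.
by rewrite mulr_ge0 ?invr_ge0 ?sqr_ge0.
Qed.

End empirical_variance.

Section expected_empirical_variance.
Context {d : measure_display} {T : measurableType d} {R : realType}.
Variable P : probability T R.
Local Notation L1 f := (P.-integrable setT (EFin \o f)).
Local Notation E f := (Rintegral P setT f).

Lemma L1_emp_var m (x : 'I_m -> T -> R) : (forall i, sqint P (x i)) ->
  L1 (fun w => emp_var (x ^~ w)).
Proof.
move=> sx; apply: L1Zl; apply: L1_sum => i _; apply: L1_sum => j _.
apply: eq_L1 (L1Zl 2^-1 (sqintB (sx i) (sx j)).2) => w; exact: mulrC.
Qed.

(** The factor 2 bounds m/(m-1), as m >= 2. *)
Lemma E_emp_var_le m (x : 'I_m -> T -> R) C : (1 < m)%N ->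
  (forall i, sqint P (x i)) -> (forall i, E (fun w => x i w ^+ 2) <= C) ->
  E (fun w => emp_var (x ^~ w)) <= 2 * C.
Proof.
move=> m1 sx xC.
have Isum : L1 (fun w => \sum_i x i w ^+ 2) by apply: L1_sum => i _; exact: (sx i).2.
apply: (@le_trans _ _ (E (fun w => m.-1%:R^-1 * \sum_i x i w ^+ 2))).
  by apply: E_le => [||w]; [exact: L1_emp_var|exact: L1Zl|exact: emp_var_le].
rewrite EZl// E_sum; last by move=> i _; exact: (sx i).2.
have m10 : 0 < m.-1%:R :> R by rewrite ltr0n; lia.
rewrite ler_pdivrMl//.
apply: (@le_trans _ _ (\sum_(i < m) C)); first exact: ler_sum.
have C0 : 0 <= C.
  by apply: le_trans (xC (Ordinal m1)); apply: E_ge0 => w; exact: sqr_ge0.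
rewrite sumr_const card_ord -[C *+ m]mulr_natl mulrA ler_wpM2r//.
by rewrite -natrM ler_nat; lia.
Qed.

(* To be used with t small first, then D small compared to t. *)
Lemma E_emp_var_perturb t m (x z : 'I_m -> T -> R) C D : 0 < t -> (1 < m)%N ->
  (forall i, sqint P (x i)) -> (forall i, E (fun w => x i w ^+ 2) <= C) ->
  (forall i, sqint P (z i)) ->
  (forall i, E (fun w => (z i w - x i w) ^+ 2) <= D) ->
  E (fun w => `|emp_var (z ^~ w) - emp_var (x ^~ w)|) <=
    t * (2 * C) + (1 + t^-1) * (2 * D).
Proof.
move=> t0 m1 sx xC sz zD.
have szx i : sqint P (fun w => z i w - x i w) by exact: sqintB.
have Ix := L1_emp_var sx; have Iz := L1_emp_var sz; have Izx := L1_emp_var szx.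
apply: (@le_trans _ _ (E (fun w => t * emp_var (x ^~ w) +
    (1 + t^-1) * emp_var (fun i => z i w - x i w)))).
  apply: E_le => [||w].
  - exact: L1_norm (L1B Iz Ix).
  - by apply: L1D; exact: L1Zl.
  - exact: emp_var_perturb.
rewrite ED; [|exact: L1Zl|exact: L1Zl].
rewrite (EZl t)// (EZl (1 + _))//; apply: lerD; apply: ler_wpM2l.
- exact: ltW.
- exact: E_emp_var_le.
- by rewrite addr_ge0// invr_ge0 ltW.
- exact: E_emp_var_le.
Qed.

(** Meant for f1, f2, f3 the empirical variances of the [mu_hat], of the g(xi_i) and of the
    truncated g(xi_i), with c1 the truncated variance and c2 the target. Both f1 and f3 are compared
    with f2, in the order produced by [E_emp_var_perturb]. *)
Lemma E_dist_le (f1 f2 f3 : T -> R) c1 c2 : L1 f1 -> L1 f2 -> L1 f3 ->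
  E (fun w => `|f1 w - c2|) <= E (fun w => `|f1 w - f2 w|) +
    E (fun w => `|f3 w - f2 w|) + (E (fun w => `|f3 w - c1|) + `|c1 - c2|).
Proof.
move=> I1 I2 I3; have Ic c := L1_cst P c.
have I12 := L1_norm (L1B I1 I2); have I32 := L1_norm (L1B I3 I2).
have I3c := L1_norm (L1B I3 (Ic c1)).
rewrite -(ED I12 I32) -[X in _ <= _ + (_ + X)](E_cst P `|c1 - c2|) -(ED I3c (Ic _)).
rewrite -(ED (L1D I12 I32) (L1D I3c (Ic _))).
apply: E_le => [||w]; [exact: L1_norm (L1B I1 (Ic c2))| |].
  exact: (L1D (L1D I12 I32) (L1D I3c (Ic _))).
rewrite [`|f3 w - f2 w|]distrC.
rewrite (_ : f1 w - c2 = (f1 w - f2 w + (f2 w - f3 w)) + ((f3 w - c1) + (c1 - c2)));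
  last by ring.
by apply: le_trans (ler_normD _ _) _; apply: lerD; exact: ler_normD.
Qed.

Lemma variance_le_sqr f : sqint P f ->
  E (fun w => (f w - E f) ^+ 2) <= E (fun w => f w ^+ 2).
Proof.
move=> sf; have If := sqint_L1 sf.
rewrite (_ : E _ = E (fun w => f w ^+ 2 - 2 * E f * f w + E f ^+ 2)); last first.
  by apply: eq_E => w; ring.
have IfB : L1 (fun w => 2 * E f * f w) by exact: L1Zl.
rewrite ED; [|by apply: L1B => //; exact: sf.2|exact: L1_cst].
rewrite EB//; last exact: sf.2.
rewrite EZl// E_cst; have := sqr_ge0 (E f); nra.
Qed.

(** [sqr_perturb] applied to the centred variables; centring only decreases the second moments of f
    and of g - f. *)
Lemma variance_perturb t f g C D : 0 < t -> sqint P f -> sqint P g ->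
  E (fun w => f w ^+ 2) <= C -> E (fun w => (g w - f w) ^+ 2) <= D ->
  `|E (fun w => (g w - E g) ^+ 2) - E (fun w => (f w - E f) ^+ 2)| <=
    t * C + (1 + t^-1) * D.
Proof.
move=> t0 sf sg fC gD.
have sf' : sqint P (fun w => f w - E f) by apply: sqintB => //; exact: sqint_cst.
have sg' : sqint P (fun w => g w - E g) by apply: sqintB => //; exact: sqint_cst.
have sgf := sqintB sg sf.
have sgf' : sqint P (fun w => g w - f w - E (fun w => g w - f w)).
  by apply: sqintB => //; exact: sqint_cst.
have Isum : L1 (fun w => t * (f w - E f) ^+ 2 +
    (1 + t^-1) * (g w - f w - E (fun w => g w - f w)) ^+ 2).
  by apply: L1D; apply: L1Zl; [exact: sf'.2|exact: sgf'.2].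
rewrite -EB; [|exact: sg'.2|exact: sf'.2].
have IB := L1B sg'.2 sf'.2.
apply: le_trans (E_norm IB) _.
apply: (@le_trans _ _ (E (fun w => t * (f w - E f) ^+ 2 +
    (1 + t^-1) * (g w - f w - E (fun w => g w - f w)) ^+ 2))).
  apply: E_le => [||w]; [exact: L1_norm|exact: Isum|].
  rewrite EB; [|exact: sqint_L1|exact: sqint_L1].
  rewrite (_ : g w - f w - (E g - E f) = (g w - E g) - (f w - E f)); last by ring.
  exact: sqr_perturb.
rewrite (@ED _ _ _ _ (fun w => t * (f w - E f) ^+ 2)); last 2 first.
- by apply: L1Zl; exact: sf'.2.
- by apply: L1Zl; exact: sgf'.2.
rewrite (EZl t sf'.2) (EZl _ sgf'.2).
apply: lerD; apply: ler_wpM2l.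
- exact: ltW.
- exact: le_trans (variance_le_sqr sf) fC.
- by rewrite addr_ge0// invr_ge0 ltW.
- exact: le_trans (variance_le_sqr sgf) gD.
Qed.

End expected_empirical_variance.

Lemma eventually_small {R : realType} (A e : R) : 0 < e ->
  exists K : nat, forall m, (K <= m)%N ->
    A / m.-1%:R <= e /\ A / m%:R <= e.
Proof.
move=> e0; pose k := (Num.bound (`|A| / e)).+2.
have kP (m : nat) : (k.-1 <= m)%N -> A / m%:R <= e.
  move=> km; have m0 : 0 < m%:R :> R by rewrite ltr0n; lia.
  rewrite ler_pdivrMr// (le_trans (ler_norm A))// mulrC -ler_pdivrMr//.
  apply: ltW; apply: lt_le_trans (archi_boundP _) _; first by rewrite divr_ge0// ltW.
  by rewrite ler_nat; exact: leq_trans (leqnSn _) km.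
by exists k => m km; split; apply: kP; lia.
Qed.

Lemma leq_double_pred m : (1 < m)%N -> (m <= 2 * m.-1)%N.
Proof. lia. Qed.

(** * Law of large numbers for bounded i.i.d. variables *)

Section iid.
Context {d : measure_display} {T : measurableType d} {R : realType}.
Variable P : probability T R.
Local Notation L1 f := (P.-integrable setT (EFin \o f)).
Local Notation E f := (Rintegral P setT f).
Variable xi : nat -> {RV P >-> R}.
Hypothesis xi_indep : forall i j, i != j -> independent_elements P (xi i) (xi j).
Hypothesis xi_law : forall i j (B : set R), measurable B ->
  P (xi i @^-1` B) = P (xi j @^-1` B).

Lemma E_iid (f : R -> R) i j : measurable_fun setT f -> L1 (f \o xi i) ->
  E (fun w => f (xi j w)) = E (fun w => f (xi i w)).
Proof.
move=> mf If.
have If' : L1 (f \o xi j).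
  by apply: (@eq_law_L1 _ _ _ P _ _ (xi i)) => // A mA; exact: xi_law.
rewrite -[LHS](E_distribution mf If') -[RHS](E_distribution mf If).
by apply: eq_law_E => A mA; exact: xi_law.
Qed.

Lemma sqint_iid (f : R -> R) i j : measurable_fun setT f ->
  sqint P (fun w => f (xi i w)) -> sqint P (fun w => f (xi j w)).
Proof.
move=> mf [_ If]; split; first exact: measurableT_comp.
have mf2 : measurable_fun setT (fun x => f x ^+ 2) by exact: measurable_funX.
by apply: (@eq_law_L1 _ _ _ P _ _ (xi i) _ _ mf2 _ If) => A mA; exact: xi_law.
Qed.

Lemma E_iidM (a b : R -> R) i j : i != j ->
  measurable_fun setT a -> measurable_fun setT b ->
  sqint P (fun w => a (xi i w)) -> sqint P (fun w => b (xi j w)) ->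
  E (fun w => a (xi i w) * b (xi j w)) =
  E (fun w => a (xi i w)) * E (fun w => b (xi j w)).
Proof.
move=> ij ma mb sa sb; pose f (su : R * R) := b su.2.
have mf : measurable_fun setT f by exact: measurableT_comp.
rewrite (freezeM (f := f) (xi_indep ij) ma mf (sqint_L1 sb) (sqintM_L1 sa sb)).2.
have -> : freeze P (xi j) f = fun=> E (fun w => b (xi j w)).
  by apply/funext => s; exact: (E_distribution mb (sqint_L1 sb)).
rewrite mulrC -EZl; last exact: sqint_L1.
by apply: eq_E => w; rewrite mulrC.
Qed.

Lemma E_sqr_sum_iid (u : R -> R) m : measurable_fun setT u ->
  sqint P (fun w => u (xi 0%N w)) -> E (fun w => u (xi 0%N w)) = 0 ->
  E (fun w => (\sum_(i < m) u (xi i w)) ^+ 2) =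
  m%:R * E (fun w => u (xi 0%N w) ^+ 2).
Proof.
move=> mu su u0; have sui i := sqint_iid i mu su.
rewrite E_sqr_sum//.
rewrite (eq_bigr (fun=> E (fun w => u (xi 0%N w) ^+ 2))).
  by rewrite sumr_const card_ord [RHS]mulr_natl.
move=> i _; rewrite (bigD1 i)//= big1 ?addr0.
  by apply: (@E_iid (fun x => u x ^+ 2) 0) su.2; exact: measurable_funX.
move=> j ji; rewrite E_iidM 1?eq_sym//.
by rewrite (E_iid i mu (sqint_L1 su)) u0 mul0r.
Qed.

(** With S and U the sums of s(xi_i) and u(xi_i), the error is S/(m-1) + v/(m-1) - U^2/(m(m-1)).
    Boundedness of f puts s in L^2, so S^2 and U^2 have means of order m. *)
Lemma emp_var_lln (f : R -> R) (B e : R) : measurable_fun setT f ->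
  (forall x, `|f x| <= B) -> 0 < e ->
  exists K : nat, forall m, (K <= m)%N ->
  E (fun w => `|emp_var (fun i : 'I_m => f (xi i w)) -
     E (fun w => (f (xi 0%N w) - E (fun w => f (xi 0%N w))) ^+ 2)|) <= e.
Proof.
move=> mf fB e0; set mu := E (fun w => f (xi 0%N w)).
set v := E (fun w => (f (xi 0%N w) - mu) ^+ 2).
pose u x := f x - mu; pose s x := u x ^+ 2 - v.
have B0 : 0 <= B := le_trans (normr_ge0 _) (fB 0).
have m_u : measurable_fun setT u by exact: measurable_funB.
have m_s : measurable_fun setT s by apply: measurable_funB => //; exact: measurable_funX.
have sb (k : R -> R) M i : measurable_fun setT k -> (forall x, `|k x| <= M) ->
    sqint P (fun w => k (xi i w)).
  by move=> mk kM; apply: (@sqint_bounded _ _ _ _ _ M) => //; exact: measurableT_comp.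
have uB x : `|u x| <= B + `|mu| by rewrite (le_trans (ler_normB _ _))// lerD2r.
have su i : sqint P (fun w => u (xi i w)) by exact: sb uB.
have ss i : sqint P (fun w => s (xi i w)).
  apply: (sb _ ((B + `|mu|) ^+ 2 + `|v|)) => // x.
  rewrite (le_trans (ler_normB _ _))// lerD2r normrX.
  by rewrite lerXn2r// nnegrE addr_ge0.
have Eu : E (fun w => u (xi 0%N w)) = 0.
  rewrite EB; [|exact: sqint_L1 (sb _ _ _ mf fB)|exact: L1_cst].
  by rewrite E_cst subrr.
have Es : E (fun w => s (xi 0%N w)) = 0.
  rewrite EB; [|exact: (su _).2|exact: L1_cst].
  by rewrite E_cst subrr.
set C := E (fun w => s (xi 0%N w) ^+ 2).
have e2 : 0 < e / 2 by rewrite divr_gt0.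
(* The expectation of [bound] is at most t + (4C/e + 2v)/(m-1) with t = e/2, using m/(m-1) <= 2. *)
have [K KP] := @eventually_small R (4 * C / e + 2 * v) (e / 2) e2.
exists (maxn K 2) => m; rewrite geq_max => /andP[/KP[Km _] m1].
have m10 : 0 < m.-1%:R :> R by rewrite ltr0n; lia.
have m0 : 0 < m%:R :> R by rewrite ltr0n; lia.
have v0 : 0 <= v by apply: E_ge0 => w; exact: sqr_ge0.
have C0 : 0 <= C by apply: E_ge0 => w; exact: sqr_ge0.
pose t := e / 2; have t0 : 0 < t by rewrite divr_gt0.
have Isum : L1 (fun w => (\sum_(i < m) s (xi i w)) ^+ 2) by exact: (sqint_sum _ _).2.
have Usum : L1 (fun w => (\sum_(i < m) u (xi i w)) ^+ 2) by exact: (sqint_sum _ _).2.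
(* The term |S|/(m-1) is replaced through |z| <= t + z^2/t, so that only second moments have to be
   computed. *)
pose bound w := (t + v / m.-1%:R) + (t^-1 * m.-1%:R ^- 2 * (\sum_(i < m) s (xi i w)) ^+ 2 +
  m.-1%:R^-1 * m%:R^-1 * (\sum_(i < m) u (xi i w)) ^+ 2).
have Iev : L1 (fun w => emp_var (fun i : 'I_m => f (xi i w))).
  by apply: (@L1_emp_var _ _ _ _ _ (fun (i : 'I_m) w => f (xi i w))) => i; exact: sb fB.
apply: (@le_trans _ _ (E bound)).
  apply: E_le => [||w].
  - by apply: L1_norm; apply: L1B => //; exact: L1_cst.
  - by apply: L1D; [exact: L1_cst|apply: L1D; exact: L1Zl].
  rewrite -(emp_var_shift _ mu) emp_varE// -/u.
  set S := \sum_(i < m) s (xi i w); set U := \sum_(i < m) u (xi i w).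
  have -> : \sum_(i < m) (f (xi i w) - mu) ^+ 2 = S + m%:R * v.
    by rewrite /S sumrB sumr_const card_ord -[v *+ m]mulr_natl subrK.
  have mE : m%:R = m.-1%:R + 1 :> R by rewrite natr1 prednK// ltnW.
  have -> : m.-1%:R^-1 * (S + m%:R * v - m%:R^-1 * U ^+ 2) - v =
      m.-1%:R^-1 * S + v / m.-1%:R - m.-1%:R^-1 * m%:R^-1 * U ^+ 2.
    by rewrite mE; field; rewrite -mE !gt_eqF.
  apply: le_trans (ler_normB _ _) _.
  rewrite (ger0_norm (x := _ * U ^+ 2)); last by rewrite mulr_ge0 ?sqr_ge0// mulr_ge0// invr_ge0.
  rewrite /bound -/S -/U addrA lerD2r addrAC.
  apply: le_trans (ler_normD _ _) _.
  rewrite (ger0_norm (x := v / _)) ?divr_ge0// lerD2r.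
  set z := m.-1%:R^-1 * S.
  have -> : t^-1 * m.-1%:R ^- 2 * S ^+ 2 = t^-1 * `|z| ^+ 2.
    by rewrite real_normK ?num_real// /z exprMn exprVn -[LHS]mulrA.
  have := normr_ge0 z; move: `|z| => y y0.
  have : 0 <= t^-1 * (y - t) ^+ 2 by rewrite mulr_ge0 ?sqr_ge0// invr_ge0 ltW.
  have -> : t^-1 * (y - t) ^+ 2 = t^-1 * y ^+ 2 - 2 * y + t by field; rewrite gt_eqF.
  by move=> ?; lra.
rewrite /bound ED; [|exact: L1_cst|by apply: L1D; exact: L1Zl].
rewrite E_cst ED; [|exact: L1Zl|exact: L1Zl].
rewrite !EZl// !E_sqr_sum_iid// -/C -/v.
have mm : m%:R <= 2 * m.-1%:R :> R by rewrite -natrM ler_nat leq_double_pred.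
apply: (@le_trans _ _ (t + (4 * C / e + 2 * v) / m.-1%:R)); last first.
  by rewrite [leRHS]splitr lerD2l.
rewrite -addrA lerD2l.
have -> : v / m.-1%:R + (t^-1 * m.-1%:R ^- 2 * (m%:R * C) +
    m.-1%:R^-1 * m%:R^-1 * (m%:R * v)) =
    (t^-1 * (m%:R / m.-1%:R * C) + 2 * v) / m.-1%:R.
  by field; rewrite !gt_eqF.
rewrite ler_wpM2r ?invr_ge0 ?ler0n// lerD2r.
have -> : 4 * C / e = t^-1 * (2 * C) by rewrite /t; field; rewrite gt_eqF.
apply: ler_wpM2l; first by rewrite invr_ge0 ltW.
by apply: ler_wpM2r => //; rewrite ler_pdivrMr.
Qed.

End iid.

(** * Consistency *)

Section row_variance.
Context {d : measure_display} {Omega : measurableType d} {R : realType}.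
Variable P : probability Omega R.
Variables (xi eta : nat -> {RV P >-> R}) (zeta : nat -> nat -> {RV P >-> R}).
Local Notation X := (AHK_variables xi eta zeta).
Hypothesis indX : mutually_independent X.
Hypothesis lawX : forall k l (B : set R), measurable B ->
  P (X k @^-1` B) = P (X l @^-1` B).
Variables (p q : nat) (h : 'M[R]_(p, q) -> R).
Hypotheses (p_gt0 : (0 < p)%N) (q_gt0 : (0 < q)%N).
Hypothesis h_kernel : kernel_function h.
Variable psi : R * R * R -> R.
Hypothesis mpsi : measurable_fun setT psi.
Local Notation W := (kernel_at xi eta zeta h psi).
Hypothesis kernel_sqint : sqint P (W val val).

Local Notation L1 f := (P.-integrable setT (EFin \o f)).
Local Notation E f := (Rintegral P setT f).
Local Notation y w := (fun i j => psi (xi i w, eta j w, zeta i j w)).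
Local Notation g := (row_projection xi eta zeta h p_gt0 psi).

Let xi_indep i j : i != j -> independent_elements P (xi i) (xi j).
Proof.
move=> ij A B mA mB.
pose k (i : nat) : (nat + nat) + nat * nat := inl (inl i).
apply: (@independent_blocks _ _ _ P _ X [:: k i] [:: k j]) => //.
- by rewrite /= inE andbT; apply: contra ij => /eqP[->].
- by apply: sub_sigma_algebra; exists (k i); [exact: mem_head|exists A; rewrite ?setTI].
- by apply: sub_sigma_algebra; exists (k j); [exact: mem_head|exists B; rewrite ?setTI].
Qed.

Let xi_law i j (B : set R) : measurable B ->
  P (xi i @^-1` B) = P (xi j @^-1` B).
Proof. exact: (lawX (inl (inl i)) (inl (inl j))). Qed.

Let v := E (fun w => (g (xi 0%N w) - E (fun w => g (xi 0%N w))) ^+ 2).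

(** The error e is shared equally by four steps: from [mu_hat] to g, from g to its truncation, the
    law of large numbers, and the return from the truncated variance to v. *)
Lemma v10_hat_L1 e : 0 < e -> exists K : nat, forall m n, (K <= m)%N -> (K <= n)%N ->
  L1 (fun w => v10_hat h (y w) m n - v) /\
  E (fun w => `|v10_hat h (y w) m n - v|) <= e.
Proof.
move=> e0.
have mg : measurable_fun setT g by exact: measurable_row_projection.
have sg i : sqint P (fun w => g (xi i w)) by exact: sqint_row_projection.
set C := E (fun w => g (xi 0%N w) ^+ 2).
have C0 : 0 <= C by apply: E_ge0 => w; exact: sqr_ge0.
have gC i : E (fun w => g (xi i w) ^+ 2) <= C.
  rewrite le_eqVlt; apply/orP; left; apply/eqP.
  by apply: (E_iid xi_law i (measurable_funX 2 mg)); exact: (sg 0%N).2.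
(* This makes t (2C) at most e/8; C + 1 guards against C = 0. *)
pose t := e / (16 * (C + 1)).
have t0 : 0 < t by rewrite divr_gt0// mulr_gt0// ltr_wpDl.
have tC : t * (2 * C) <= e / 8.
  rewrite /t [leLHS](_ : _ = e / 8 * (C / (C + 1))); last first.
    by field; rewrite gt_eqF// ltr_wpDl.
  apply: ler_piMr; first by rewrite divr_ge0// ltW.
  by rewrite ler_pdivrMr ?ltr_wpDl// mul1r lerDl.
have t1 : 0 < 1 + t^-1 by rewrite addr_gt0 ?invr_gt0.
(* The mean-square tolerance for both the truncation and the [mu_hat], chosen so that its
   contribution is the other e/8. Rows and columns each get k/2 of the [mu_hat] error. *)
pose k := e / (16 * (1 + t^-1)).
have k0 : 0 < k by apply: divr_gt0 => //; exact: mulr_gt0.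
have tk : (1 + t^-1) * (2 * k) = e / 8 by rewrite /k; field; rewrite (gt_eqF t0) gt_eqF//; move: t1 t0; nra.
have [L LP] : exists L : nat,
    E (fun w => (g (xi 0%N w) - truncate L%:R (fun w => g (xi 0%N w)) w) ^+ 2) <= k.
  have /cvgrPdist_le/(_ k k0)[L _ LP] := cvg_truncate (sg 0%N).
  exists L; have := LP L (leqnn L); rewrite sub0r normrN.
  by apply: le_trans; exact: ler_norm.
pose gL := truncate L%:R g.
have mgL : measurable_fun setT gL by exact: measurable_truncate.
have gLB x : `|gL x| <= L%:R by exact: truncate_bounded.
have sgL i : sqint P (fun w => gL (xi i w)).
  by apply: (@sqint_bounded _ _ _ _ _ L%:R) => //; exact: measurableT_comp.
have gLk i : E (fun w => (gL (xi i w) - g (xi i w)) ^+ 2) <= k.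
  have mD : measurable_fun setT (fun x => (gL x - g x) ^+ 2).
    by apply: measurable_funX; exact: measurable_funB.
  rewrite (@E_iid _ _ _ _ _ xi_law _ 0%N i mD); last first.
    exact: (sqintB (sgL 0%N) (sg 0%N)).2.
  apply: le_trans LP; rewrite le_eqVlt; apply/orP; left; apply/eqP.
  by apply: eq_E => w; rewrite -sqrrN opprB.
have e4 : 0 < e / 4 by rewrite divr_gt0.
have [K1 K1P] := emp_var_lln xi_indep xi_law mgL gLB e4.
set M2 := E (fun w => W val val w ^+ 2).
have k2 : 0 < k / 2 by rewrite divr_gt0.
have [K2 K2P] := eventually_small (M2 * p.-1%:R ^+ 2) k2.
have [K3 K3P] := eventually_small (M2 * q%:R ^+ 2) k2.
exists (maxn (maxn K1 K2) (maxn K3 (maxn p (maxn q 2)))) => m n.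
rewrite !geq_max => /andP[/andP[mK1 mK2] /and4P[_ pm _ m1]].
move=> /andP[_ /and4P[nK3 _ qn _]].
have mumg (i : 'I_m) := mu_hat_mean_square indX lawX p_gt0 q_gt0 h_kernel mpsi
  kernel_sqint i pm qn m1.
have muk (i : 'I_m) : E (fun w => (mu_hat h (y w) n i - g (xi i w)) ^+ 2) <= k.
  apply: le_trans (mumg i).2 _; rewrite -/M2 mulrDr [leRHS]splitr.
  by rewrite lerD// mulrA; [exact: (K2P _ mK2).1|exact: (K3P _ nK3).2].
have smu (i : 'I_m) : sqint P (fun w => mu_hat h (y w) n i).
  by apply: eq_sqint (sqintD (mumg i).1 (sg i)) => w; rewrite subrK.
pose xg (i : 'I_m) w := g (xi i w).
pose xL (i : 'I_m) w := gL (xi i w).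
pose xm (i : 'I_m) w := mu_hat h (y w) n i.
have Im : L1 (fun w => emp_var (xm ^~ w)).
  exact: (@L1_emp_var _ _ _ P _ xm smu).
have Ig : L1 (fun w => emp_var (xg ^~ w)).
  exact: (@L1_emp_var _ _ _ P _ xg (fun i => sg i)).
have IL : L1 (fun w => emp_var (xL ^~ w)).
  exact: (@L1_emp_var _ _ _ P _ xL (fun i => sgL i)).
set vL := E (fun w => (gL (xi 0%N w) - E (fun w => gL (xi 0%N w))) ^+ 2).
have d1 : E (fun w => `|emp_var (xm ^~ w) - emp_var (xg ^~ w)|) <= e / 8 + e / 8.
  rewrite -[X in _ + X]tk; apply: le_trans (_ : t * (2 * C) + _ <= _).
    exact: (E_emp_var_perturb (x := xg) (z := xm) t0 m1
      (fun i => sg i) (fun i => gC i) smu muk).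
  by rewrite lerD2r.
have d2 : E (fun w => `|emp_var (xL ^~ w) - emp_var (xg ^~ w)|) <= e / 8 + e / 8.
  rewrite -[X in _ + X]tk; apply: le_trans (_ : t * (2 * C) + _ <= _).
    exact: (E_emp_var_perturb (x := xg) (z := xL) t0 m1
      (fun i => sg i) (fun i => gC i) (fun i => sgL i) (fun i => gLk i)).
  by rewrite lerD2r.
have d3 : `|vL - v| <= e / 4.
  apply: le_trans (variance_perturb t0 (sg 0%N) (sgL 0%N) (gC 0%N) (gLk 0%N)) _.
  have tk0 : 0 <= (1 + t^-1) * k by rewrite mulr_ge0 ?ltW.
  have tC0 : 0 <= t * C by rewrite mulr_ge0// ltW.
  move: tC tk; rewrite !(mulrCA _ 2) => tC tk; lra.
have d4 : E (fun w => `|emp_var (xL ^~ w) - vL|) <= e / 4 by exact: K1P.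
split; first exact: L1B Im (L1_cst P v).
apply: le_trans (E_dist_le vL v Im Ig IL) _.
rewrite [leRHS](_ : _ = e / 8 + e / 8 + (e / 8 + e / 8) + (e / 4 + e / 4)); last by field.
by apply: lerD; apply: lerD.
Qed.

End row_variance.

(** * Convergence in mean to a constant *)

Section mean_convergence.
Context {d : measure_display} {T : measurableType d} {R : realType}.
Variable P : probability T R.
Local Notation L1 f := (P.-integrable setT (EFin \o f)).
Local Notation E f := (Rintegral P setT f).
Implicit Types (X : nat -> T -> R) (c : R).

(** Integrability is part of the definition because [Rintegral] is [fine] of an integral, hence 0
    when that integral is infinite. *)
Definition cvg_in_mean X c := forall e : R, 0 < e ->
  exists N0 : nat, forall N, (N0 <= N)%N ->
    L1 (fun w => X N w - c) /\ E (fun w => `|X N w - c|) <= e.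

Lemma markov_L1 (f : T -> R) e : 0 < e -> L1 f ->
  (P [set w | (e < `|f w|)%R] <= (E (fun w => `|f w|) / e)%:E)%E.
Proof.
move=> e0 If; have mf := L1_measurable If.
have mEf : measurable_fun setT (EFin \o (fun w => `|f w|)).
  by apply/measurable_EFinP; exact: measurableT_comp.
rewrite mulrC EFinM EFin_E ?lee_pdivlMl//; last exact: L1_norm.
have mlt : measurable [set w | (e < `|f w|)%R].
  have := measurable_lte measurableT (@measurable_cst _ _ _ _ setT e%:E) mEf.
  by rewrite setTI.
have mle : measurable [set w | (e%:E <= `|(EFin \o f) w|)%E].
  have := measurable_lee measurableT (@measurable_cst _ _ _ _ setT e%:E) mEf.
  by rewrite setTI.
have := @le_integral_comp_abse _ _ _ P _ measurableT (EFin \o f) e id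
  (@measurable_id _ _ _) (fun _ => id) (fun _ _ _ _ => id)
  (proj2 (measurable_EFinP _ _) mf) e0.
apply: le_trans; rewrite setTI lee_wpmul2l//; first by rewrite lee_fin ltW.
by apply: le_measure; rewrite ?inE// => w /= ew; rewrite lee_fin ltW.
Qed.

Lemma cvg_in_mean_probability X c : cvg_in_mean X c ->
  cvg_in_probability P X (cst c).
Proof.
move=> Xc e e0.
have Pk k : 0 < k -> exists N0 : nat, forall N, (N0 <= N)%N ->
    (P [set w | (e < `|X N w - cst c w|)%R] <= k%:E)%E.
  move=> k0; have [N0 N0P] := Xc (k * e) (mulr_gt0 k0 e0).
  exists N0 => N /N0P[IX EX]; apply: le_trans (markov_L1 e0 IX) _.
  by rewrite lee_fin ler_pdivrMr.
apply/fine_cvgP; split.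
  have [N0 N0P] := Pk 1 ltr01; exists N0 => //= N /N0P Ple.
  by rewrite ge0_fin_numE// (le_lt_trans Ple)// ltry.
apply/cvgrPdist_le => k k0; have [N0 N0P] := Pk k k0; exists N0 => //= N /N0P Ple.
rewrite sub0r normrN ger0_norm ?fine_ge0//.
by rewrite -lee_fin fineK// ge0_fin_numE// (le_lt_trans Ple)// ltry.
Qed.

Lemma cvg_in_meanD (a b : R) X X' c c' : cvg_in_mean X c -> cvg_in_mean X' c' ->
  cvg_in_mean (fun N w => a * X N w + b * X' N w) (a * c + b * c').
Proof.
move=> Xc Xc' e e0.
pose k := e / (`|a| + `|b| + 1).
have s0 : 0 < `|a| + `|b| + 1 by rewrite ltr_wpDl// addr_ge0.
have k0 : 0 < k by rewrite divr_gt0.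
have [N1 N1P] := Xc k k0; have [N2 N2P] := Xc' k k0.
exists (maxn N1 N2) => N; rewrite geq_max => /andP[/N1P[I1 E1] /N2P[I2 E2]].
have eqX w : a * X N w + b * X' N w - (a * c + b * c') =
  a * (X N w - c) + b * (X' N w - c') by ring.
have IS : L1 (fun w => a * X N w + b * X' N w - (a * c + b * c')).
  by apply: eq_L1 (L1D (L1Zl a I1) (L1Zl b I2)) => w; rewrite eqX.
split => //.
have J1 := L1Zl `|a| (L1_norm I1); have J2 := L1Zl `|b| (L1_norm I2).
apply: (@le_trans _ _ (E (fun w => `|a| * `|X N w - c| + `|b| * `|X' N w - c'|))).
  apply: E_le => [||w]; [exact: L1_norm|exact: L1D|].
  by rewrite eqX (le_trans (ler_normD _ _))// !normrM.
rewrite (ED J1 J2) (EZl _ (L1_norm I1)) (EZl _ (L1_norm I2)).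
have h1 := ler_wpM2l (normr_ge0 a) E1; have h2 := ler_wpM2l (normr_ge0 b) E2.
apply: le_trans (lerD h1 h2) _; rewrite -mulrDl /k mulrCA.
apply: ler_piMr; first exact: ltW.
by rewrite ler_pdivrMr// mul1r lerDl.
Qed.

(** Carries the limit from entries computed with [psi] to the entries of Y. Measurability of X' is a
    separate premise, as P need not be complete. *)
Lemma cvg_in_mean_ae X X' c : (forall N, measurable_fun setT (X' N)) ->
  (forall N, {ae P, forall w, X N w = X' N w}) ->
  cvg_in_mean X c -> cvg_in_mean X' c.
Proof.
move=> mX' XX' Xc e /Xc[N0 N0P]; exists N0 => N /N0P[IX EX].
have mX := L1_measurable IX.
have mXc' : measurable_fun setT (fun w => X' N w - c) by exact: measurable_funB.
have XXc : {ae P, forall w, `|X N w - c| = `|X' N w - c|}.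
  by apply: filterS (XX' N) => w ->.
have mn (f : T -> R) : measurable_fun setT f -> measurable_fun setT (fun w => `|f w|).
  by move=> mf; exact: measurableT_comp.
split; last by rewrite -(E_ae (mn _ mX) (mn _ mXc') XXc).
apply/integrableP; split; first exact/measurable_EFinP.
case/integrableP : IX => mEX; congr (_ < _)%E; apply: ae_eq_integral => //.
- exact: measurableT_comp.
- by apply: measurableT_comp => //; exact/measurable_EFinP.
- by apply: filterS XXc => w /= -> _.
Qed.

End mean_convergence.

(** * Measurability and transposition of the estimators *)

Section estimators.
Context {d : measure_display} {Omega : measurableType d} {R : realType}.
Variables (p q : nat) (h : 'M[R]_(p, q) -> R).
Hypothesis h_kernel : kernel_function h.

Lemma measurable_sum_cond (I : Type) (s : seq I) (Q : pred I) (f : I -> Omega -> R) :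
  (forall i, Q i -> measurable_fun setT (f i)) ->
  measurable_fun setT (fun w => \sum_(i <- s | Q i) f i w).
Proof.
move=> mf; rewrite (_ : (fun w => _) =
    fun w => \sum_(i <- s) (if Q i then f i w else 0)).
  by apply: measurable_sum => i; case: (boolP (Q i)) => // /mf.
by apply/funext => w; rewrite big_mkcond.
Qed.

Lemma measurable_v10_hat (y : nat -> nat -> Omega -> R) m n :
  (forall i j, measurable_fun setT (y i j)) ->
  measurable_fun setT (fun w => v10_hat h (fun i j => y i j w) m n).
Proof.
move=> my; have mmu (i : 'I_m) :
    measurable_fun setT (fun w => mu_hat h (fun i j => y i j w) n i).
  rewrite /mu_hat; apply: measurable_funM; first exact: measurable_cst.
  apply: measurable_sum_cond => I _.
  apply: measurable_sum_cond => J _.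
  apply: (measurable_kernel_function
    (M := fun w => submatrix p q (fun i j => y i j w) I J) h_kernel) => a b.
  rewrite (_ : (fun t => _) = y (nth 0%N [seq val i | i <- enum I] a)
    (nth 0%N [seq val j | j <- enum J] b))//.
  by apply/funext => w; rewrite mxE.
apply: measurable_funM => //; apply: measurable_sum_cond => i _.
apply: measurable_sum_cond => j _; apply: measurable_funM => //.
by apply: measurable_funX; exact: measurable_funB.
Qed.

Definition transpose_kernel (M : 'M[R]_(q, p)) : R := h M^T.

Lemma transpose_kernel_function : kernel_function transpose_kernel.
Proof.
split=> [B mB|s t M].
  pose G := \bigcup_(ab in setT) preimage_set_system setT
    (fun M : 'M[R]_(q, p) => M ab.1 ab.2) measurable.
  have := measurable_kernel_function (T := g_sigma_algebraType G) (M := @trmx R q p) h_kernel.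
  move=> /(_ _ measurableT B mB); rewrite setTI; apply => a b.
  move=> _ C mC; rewrite setTI; apply: sub_sigma_algebra.
  exists (b, a) => //; exists C => //; rewrite setTI.
  by apply/seteqP; split => M /=; rewrite mxE.
rewrite /transpose_kernel -[in RHS](kernel_invariant h_kernel t s).
by congr h; apply/matrixP => a b; rewrite !mxE.
Qed.

Lemma nu_hat_transpose (y : nat -> nat -> R) m n (j : 'I_n) :
  nu_hat h y m j = mu_hat transpose_kernel (fun i j => y j i) m j.
Proof.
rewrite /nu_hat /mu_hat [X in X * _]mulrC exchange_big/=; congr (_ * _).
apply: eq_bigr => J _; apply: eq_bigr => I _; congr h.
by apply/matrixP => a b; rewrite !mxE.
Qed.

Lemma v01_hat_transpose (y : nat -> nat -> R) m n :
  v01_hat h y m n = v10_hat transpose_kernel (fun i j => y j i) n m.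
Proof.
congr (_ * _); apply: eq_bigr => i _; apply: eq_bigr => j _.
by rewrite !nu_hat_transpose.
Qed.

Lemma h_leading_transpose (P : probability Omega R) (Y : nat -> nat -> {RV P >-> R}) :
  h_leading transpose_kernel (fun i j => Y j i) = h_leading h Y.
Proof.
by apply/funext => w; congr h; apply/matrixP => a b; rewrite !mxE.
Qed.

End estimators.

(** * Passage from the AHK representation to the estimators *)

Section representation.
Context {d : measure_display} {Omega : measurableType d} {R : realType}.
Variable P : probability Omega R.
Local Notation L1 f := (P.-integrable setT (EFin \o f)).
Local Notation E f := (Rintegral P setT f).

(** The form of the representation that the estimates consume: psi is measurable on the whole space,
    and a single null set covers all entries. *)
Record total_representation (Y : nat -> nat -> {RV P >-> R}) (psi : R * R * R -> R)
    (xi eta : nat -> {RV P >-> R}) (zeta : nat -> nat -> {RV P >-> R}) : Prop := {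
  total_measurable : measurable_fun setT psi;
  total_independent : mutually_independent (AHK_variables xi eta zeta);
  total_law : forall k l (B : set R), measurable B ->
    P (AHK_variables xi eta zeta k @^-1` B) = P (AHK_variables xi eta zeta l @^-1` B);
  total_eq : {ae P, forall w, forall i j, Y i j w = psi (xi i w, eta j w, zeta i j w)} }.

(* psi is phi extended by 0 outside the unit cube, where nothing is known of phi. *)
Lemma AHK_total Y phi xi eta zeta : AHK_representation Y phi xi eta zeta ->
  exists psi, total_representation Y psi xi eta zeta.
Proof.
move=> [mphi indX uniX YE].
pose cube : set (R * R * R) :=
  (`[0, 1] : set R) `*` (`[0, 1] : set R) `*` (`[0, 1] : set R).
have mcube : measurable cube by apply: measurableX => //; exact: measurableX.
exists ((fun x => phi x.1.1 x.1.2 x.2) \_ cube); split => //.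
- by apply/measurable_restrict => //; rewrite setTI.
- by move=> k l B mB; have := uniX k B mB; rewrite -(uniX l B mB).
(* Uniform variables lie in the unit interval almost surely, so the value 0 off the cube is seen
   only on a null set; countably many null sets are then merged. *)
have X01 k : {ae P, forall w, AHK_variables xi eta zeta k w \in `[0, 1]}.
  exists (AHK_variables xi eta zeta k @^-1` ~` `[0, 1]%classic); split.
  - by apply: measurable_RV_preimage; exact: measurableC.
  - have := uniX k (~` `[0, 1]%classic) (measurableC (measurable_itv _)).
    rewrite /distribution /= /pushforward => ->; rewrite /uniform_prob.
    rewrite integral_uniform_pdf setICl; exact: integral_set0.
  - by move=> w /=; apply: contra_not.
apply: (ae_foralln (P := fun i w => forall j, _)) => i; apply: ae_foralln => j.
move: (X01 (inl (inl i))) (X01 (inl (inr j))) (X01 (inr (i, j))) => /= ci cj cij.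
apply: filterS2 (YE i j) (filterI ci (filterI cj cij)) => w /= -> [xw [ew zw]].
by rewrite patchE ifT//; apply/mem_set.
Qed.

Lemma total_representation_transpose Y psi xi eta zeta :
  total_representation Y psi xi eta zeta ->
  total_representation (fun i j => Y j i) (fun x => psi (x.1.2, x.1.1, x.2))
    eta xi (fun i j => zeta j i).
Proof.
move=> [mpsi indX lawX YE].
pose f (k : (nat + nat) + nat * nat) : (nat + nat) + nat * nat := match k with
  | inl (inl i) => inl (inr i)
  | inl (inr j) => inl (inl j)
  | inr (i, j) => inr (j, i) end.
have fE : AHK_variables eta xi (fun i j => zeta j i) = AHK_variables xi eta zeta \o f.
  by apply/funext => -[[i|j]|[i j]].
split.
- apply: (measurableT_comp mpsi); apply: measurable_fun_pair; last exact: measurable_snd.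
  apply: measurable_fun_pair; apply: measurableT_comp => //; exact: measurable_fst.
- rewrite fE; apply: mutually_independent_comp => //.
  by move=> [[i|j]|[i j]] [[i'|j']|[i' j']] //= [] => [->|->|-> ->].
- by move=> k l B mB; rewrite fE; exact: lawX.
- by apply: filterS YE => w YE i j /=; rewrite YE.
Qed.

(** Stated for any total representation and any two unbounded size sequences, so that it applies to
    the transposed data as well. *)
Lemma v10_hat_cvg_in_mean Y psi xi eta zeta (p q : nat) (h : 'M[R]_(p, q) -> R)
    (m n : nat -> nat) :
  total_representation Y psi xi eta zeta ->
  (0 < p)%N -> (0 < q)%N -> kernel_function h ->
  ('E_P[fun w => ((h_leading h Y w) ^+ 2)%R] < +oo)%E ->
  (forall K : nat, exists N0 : nat, forall N, (N0 <= N)%N -> (K <= m N)%N) ->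
  (forall K : nat, exists N0 : nat, forall N, (N0 <= N)%N -> (K <= n N)%N) ->
  cvg_in_mean P (fun N w => v10_hat h (fun i j => Y i j w) (m N) (n N)) (v10 h Y xi).
Proof.
move=> [mpsi indX lawX YE] p0 q0 hk h2 mK nK.
pose W := kernel_at xi eta zeta h psi.
have mY i j : measurable_fun setT (Y i j) by exact: measurable_funP.
have mh : measurable_fun setT (h_leading h Y).
  apply: (measurable_kernel_function
    (M := fun w => leading_submatrix p q (fun i j => Y i j w)) hk) => a b.
  by rewrite (_ : (fun t => _) = Y a b)//; apply/funext => w; rewrite mxE.
have sh : sqint P (h_leading h Y).
  split=> //; apply/integrableP; split.
    by apply/measurable_EFinP; exact: measurable_funX.
  move: h2; rewrite unlock; congr (_ < _)%E; apply: eq_integral => w _ /=.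
  by rewrite ger0_norm// sqr_ge0.
have mW : measurable_fun setT (W val val).
  exact: (measurableT_comp (measurable_kernel_of_block hk mpsi)
    (measurable_block xi eta zeta _ _)).
have hW : {ae P, forall w, h_leading h Y w = W val val w}.
  by apply: filterS YE => w YE; congr h; apply/matrixP => a b; rewrite !mxE YE.
have sW : sqint P (W val val).
  split=> //; apply/integrableP; split.
    by apply/measurable_EFinP; exact: measurable_funX.
  have /integrableP[mh2] := sh.2; congr (_ < _)%E; apply: ae_eq_integral => //.
  - exact: measurableT_comp.
  - apply: measurableT_comp => //; apply/measurable_EFinP; exact: measurable_funX.
  - by apply: filterS hW => w /= -> _.
have cW := row_projection_cond_expectation indX lawX p0 hk mpsi sW.
(* The kernel of the actual entries agrees almost everywhere with the one built from psi, so both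
   have the same integrals over events of sigma(xi_1). *)
have cY : is_cond_expectation (h_leading h Y) (xi 0%N)
    (fun w => row_projection xi eta zeta h p0 psi (xi 0%N w)).
  case: cW => i1 i2 i3; split => // A SA; rewrite i3//.
  have mA : measurable A.
    by case: SA => C mC <-; rewrite setTI; exact: measurable_RV_preimage.
  apply: ae_eq_integral => //.
  - by apply/measurable_EFinP; exact: measurable_funTS.
  - by apply/measurable_EFinP; exact: measurable_funTS.
  - by apply: filterS hW => w -> _.
rewrite /v10 (fine_variance_cond_expectation (sqint_L1 sh) cY).
apply: (@cvg_in_mean_ae _ _ _ P (fun N w => v10_hat h
  (fun i j => psi (xi i w, eta j w, zeta i j w)) (m N) (n N))).
- by move=> N; apply: measurable_v10_hat.
- move=> N; apply: filterS YE => w YE; congr (v10_hat h _ _ _).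
  by apply/funext => i; apply/funext => j; rewrite YE.
move=> e e0; have [K KP] := v10_hat_L1 indX lawX p0 q0 hk mpsi sW e0.
have [N1 N1P] := mK K; have [N2 N2P] := nK K.
exists (maxn N1 N2) => N; rewrite geq_max => /andP[NN1 NN2].
by apply: KP; [exact: N1P|exact: N2P].
Qed.

End representation.

(** Eventually m_N > (rho/2) N, and N tends to infinity. *)
Lemma ratio_cvg_unbounded {R : realType} (m : nat -> nat) (rho : R) : 0 < rho ->
  ((m N)%:R / N%:R : R) @[N --> \oo] --> rho ->
  forall K : nat, exists N0 : nat, forall N, (N0 <= N)%N -> (K <= m N)%N.
Proof.
move=> rho0 /cvgrPdist_lt/(_ (rho / 2))[|N1 _ N1P K]; first by rewrite divr_gt0.
(* The successor keeps N positive, as needed to clear the denominator. *)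
exists (maxn N1 (Num.bound (K%:R / (rho / 2))).+1) => N.
rewrite geq_max => /andP[/N1P /= mN NK].
have N0 : 0 < N%:R :> R by rewrite ltr0n (leq_trans _ NK).
have r2 : 0 < rho / 2 by rewrite divr_gt0.
rewrite -(ler_nat R); move: mN; rewrite ltr_norml => /andP[_].
rewrite ltrBlDr -ltrBlDl => mN.
have {}mN : rho / 2 < (m N)%:R / N%:R by lra.
rewrite ltr_pdivlMr// in mN; apply: le_trans (ltW mN).
rewrite mulrC -ler_pdivrMr//; apply: ltW; apply: lt_le_trans (archi_boundP _) _.
  by rewrite divr_ge0// ltW.
by rewrite ler_nat ltnW.
Qed.
Theorem theorem5p3 (d : measure_display) (Omega : measurableType d)
    (R : realType) (P : probability Omega R)
    (Y : nat -> nat -> {RV P >-> R})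
    (phi : R -> R -> R -> R) (xi eta : nat -> {RV P >-> R})
    (zeta : nat -> nat -> {RV P >-> R})
    (p q : nat) (h : 'M[R]_(p, q) -> R)
    (m n : nat -> nat) (rho : R)
    (Y_rce : row_column_exchangeable Y)
    (Y_dissociated : dissociated Y)
    (Y_AHK : AHK_representation Y phi xi eta zeta)
    (p_ge1 : (1 <= p)%N) (q_ge1 : (1 <= q)%N)
    (h_kernel : kernel_function h)
    (h_square_integrable : ('E_P[fun w => ((h_leading h Y w) ^+ 2)%R] < +oo)%E)
    (rho_gt0 : 0 < rho) (rho_lt1 : rho < 1)
    (mn_sum : forall N : nat, (1 <= N)%N -> (m N + n N)%N = N)
    (m_ratio : ((m N)%:R / N%:R : R) @[N --> \oo] --> rho)
    (n_ratio : ((n N)%:R / N%:R : R) @[N --> \oo] --> 1 - rho) :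
  [/\ cvg_in_probability P
        (fun N w => v10_hat h (fun i j => Y i j w) (m N) (n N))
        (cst (v10 h Y xi)),
      cvg_in_probability P
        (fun N w => v01_hat h (fun i j => Y i j w) (m N) (n N))
        (cst (v01 h Y eta))
    & cvg_in_probability P
        (fun N w => V_hat h rho (fun i j => Y i j w) (m N) (n N))
        (cst (V_asymptotic h Y rho xi eta))].

Proof.
have [psi rep] := AHK_total Y_AHK.
have mK := ratio_cvg_unbounded rho_gt0 m_ratio.
have nK : forall K : nat, exists N0 : nat, forall N, (N0 <= N)%N -> (K <= n N)%N.
  by apply: ratio_cvg_unbounded n_ratio; rewrite subr_gt0.
have c10 := v10_hat_cvg_in_mean rep p_ge1 q_ge1 h_kernel h_square_integrable mK nK.
have c01 : cvg_in_mean P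
    (fun N w => v01_hat h (fun i j => Y i j w) (m N) (n N)) (v01 h Y eta).
  rewrite /v01 -h_leading_transpose.
  under eq_fun do under eq_fun do rewrite v01_hat_transpose.
  apply: (v10_hat_cvg_in_mean (total_representation_transpose rep)) => //.
    exact: transpose_kernel_function.
  by rewrite h_leading_transpose.
split; apply: cvg_in_mean_probability => //.
(* [V_hat] and [V_asymptotic] unfold to the same linear combination, with coefficients p^2/rho and
   q^2/(1-rho). *)
exact: cvg_in_meanD.
Qed.
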